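(* Let $H$ be a locally compact Abelian group with Haar measure $\theta$, whose topology is given by a translation invariant complete metric. Let $A$ be a contractive automorphism of $H$ with modulus $\alpha$, and let $F_{ij}$, $1\le i,j\le n$, be (possibly empty) compact families of affine maps on $H$, all of the form $x\mapsto Ax+v$ with $v\in H$, with attractor $W=W_1\times\dots\times W_n$. Let $\sigma_{ij}$ be a positive regular (finite) Borel measure on $F_{ij}$, identified with a measure on $H$ supported on $F_{ij}(0)=\{f(0)\mid f\in F_{ij}\}$, with $\sigma_{ij}:=0$ if $F_{ij}=\emptyset$. Let $\boldsymbol{s}=(\sigma_{ij}(H))$ and let $\boldsymbol{m}=(m_1,\dots,m_n)^T$ be strictly positive with $\boldsymbol{s}\boldsymbol{m}=\boldsymbol{m}$. Suppose that the measures $\sigma_{ij}=h_{ij}\theta$ are absolutely continuous with respect to $\theta$ (with $0\le h_{ij}\in L^1(H)$) and write $\boldsymbol{h}=(h_{ij})$. For $\ell\ge 0$ let $$\omega^{(\ell+1)}=\Bigl(\mathop{\ast}_{k=0}^{\ell}\alpha^{k}(A^{k}.\boldsymbol{h})\Bigr)(m_1\theta,\dots,m_n\theta)^T ,$$ that is, the product measure $f_1^{(\ell+1)}\theta\otimes\dots\otimes f_n^{(\ell+1)}\theta$ on $H^n$ with $f_i^{(\ell+1)}=\sum_j\bigl(\mathop{\ast}_{k=0}^{\ell}\alpha^{k}(A^{k}.\boldsymbol{h})\bigr)_{ij}m_j$, and assume that $\omega^{(\ell)}$ converges in the total variation norm as $\ell\to\infty$. Then there is a unique vector $\boldsymbol{g}=(g_1,\dots,g_n)^T$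 of non-negative functions in $L^1(H)$ that satisfies 1. $\boldsymbol{g}=\bigl(\mathop{\ast}_{\ell=0}^{\infty}\alpha^{\ell}(A^{\ell}.\boldsymbol{h})\bigr)\boldsymbol{m}$; 2. $g_i(x)=\alpha\sum_{j=1}^n\int_H h_{ij}(x-v)\,g_j(A^{-1}v)\,\mathrm{d}\theta(v)$ (for almost all $x$), $i=1,\dots,n$, with normalization $\int_H g_i\,\mathrm{d}\theta=m_i$ and $\mathrm{supp}(g_i)\subset W_i$. Furthermore, if the $h_{ij}$ are functions in $L^1(H)\cap L^\infty(H)$, then the functions $g_i$ are continuous on $H$ (i.e. have continuous representatives).
   Context: The modulus $\alpha>0$ of $A$ is defined by $\theta\circ A^{-1}=\alpha\theta$. Contractive means Lipschitz with constant $<1$ for the given metric. The $F_{ij}$ are compact subsets of $C(H,H)$ with the compact-open topology. The attractor is the unique tuple of nonempty compact sets $W_i\subset H$ with $W_i=\bigcup_j\bigcup_{f\in F_{ij}}f(W_j)$ for all $i$. $(A.h)(x)=h(A^{-1}x)$, applied entrywise to matrices; $h\theta$ denotes the measure with density $h$ with respect to $\theta$. The convolution of matrices of functions is the matrix product with multiplication of entries replaced by convolution, $(\boldsymbol{a}*\boldsymbol{b})_{ij}=\sum_k a_{ik}*b_{kj}$, and $\mathop{\ast}_{k=0}^{\ell}\boldsymbol{a}_k=\boldsymbol{a}_0*\boldsymbol{a}_1*\cdots*\boldsymbol{a}_\ell$. In item 1 the infinite convolution applied to $\boldsymbol{m}$ means the $L^1$-limit of $\bigl(\mathop{\ast}_{k=0}^{\ell}\alpha^{k}(A^{k}.\boldsymbol{h})\bigr)\boldsymbol{m}$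 as $\ell\to\infty$. *)

(* Defs.v *)
Set Warnings "-notation-overridden,-notation-incompatible-prefix,-ambiguous-paths".
From HB Require Import structures.
From mathcomp Require Import all_boot all_order all_algebra.
From mathcomp Require Import all_classical all_reals all_analysis.

Set Implicit Arguments.
Unset Strict Implicit.
Unset Printing Implicit Defensive.

Import Order.TTheory GRing.Theory Num.Theory.
Import numFieldNormedType.Exports.

Local Open Scope classical_set_scope.
Local Open Scope ring_scope.

Record invariant_complete_metric (R : realType) (H : topologicalZmodType)
    (dist : H -> H -> R) : Prop := InvariantCompleteMetric {
  dist_eq0 : forall x y : H, dist x y = 0 <-> x = y ;
  dist_sym : forall x y : H, dist x y = dist y x ;
  dist_triangle : forall y x z : H, dist x z <= dist x y + dist y z ;
  dist_nbhs : forall x : H, nbhs x =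
    filter_from [set e : R | 0 < e] (fun e => [set y | dist x y < e]) ;
  dist_invariant : forall x y z : H, dist (x + z) (y + z) = dist x y ;
  dist_complete : forall u : nat -> H,
    (forall e : R, 0 < e ->
       exists N, forall i j, (N <= i)%N -> (N <= j)%N -> dist (u i) (u j) < e) ->
    exists l : H, u @ \oo --> l
}.

Definition contractive (R : realType) (T : Type) (dist : T -> T -> R)
    (f : T -> T) :=
  exists2 q : R, q < 1 & forall x y : T, dist (f x) (f y) <= q * dist x y.

(* [H] with its Borel sigma-algebra; measurable types must be pointed, which
   [H] is not canonically. *)
Definition borel (H : topologicalZmodType) : Type := H.
HB.instance Definition _ (H : topologicalZmodType) := Choice.on (borel H).
HB.instance Definition _ (H : topologicalZmodType) :=
  isPointed.Build (borel H) (0 : H).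
HB.instance Definition _ (H : topologicalZmodType) :=
  @isMeasurable.Build (sigma_display (@open H)) (borel H)
    <<s @open H >> (@sigma_algebra0 _ setT (@open H))
    (@sigma_algebraC (borel H) (@open H))
    (@sigma_algebra_bigcup _ setT (@open H)).

Section affine_families.
Context {H : topologicalZmodType}.

Definition is_automorphism (A : {additive H -> H}) (Ainv : H -> H) :=
  [/\ cancel A Ainv, cancel Ainv A, continuous A & continuous Ainv].

(* Affine maps x |-> A x + v with [A] continuous are continuous, so compactness for the
   compact-open topology on all functions is compactness in C(H, H). *)
Definition compact_affine_family (A : H -> H)
    (F : set {compact-open, H -> H}) :=
  compact F /\ forall f, F f -> exists v : H, f = (fun x => A x + v).

(* [F(0)] *)
Definition translation_parts (F : set {compact-open, H -> H}) : set H :=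
  [set f 0 | f in F].

Definition is_attractor n (F : 'I_n -> 'I_n -> set {compact-open, H -> H})
    (W : 'I_n -> set H) :=
  (forall i, W i !=set0 /\ compact (W i)) /\
  (forall i, W i = \bigcup_(j in [set: 'I_n]) \bigcup_(f in F i j) (f @` W j)).

End affine_families.

Section borel_measures.
Context {R : realType} {H : topologicalZmodType}.
Implicit Types theta mu : {measure set (borel H) -> \bar R}.
Local Open Scope ereal_scope.

Definition outer_regular_at mu (B : set H) :=
  mu B = ereal_inf [set mu U | U in [set U : set H | open U /\ B `<=` U]].

Definition inner_regular_at mu (B : set H) :=
  mu B = ereal_sup [set mu K | K in [set K : set H | compact K /\ K `<=` B]].

Definition regular_measure mu :=
  forall B : set (borel H), measurable B ->
    outer_regular_at mu B /\ inner_regular_at mu B.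

(* A regular measure on [F], transported to [H] along f |-> f 0, which is
   injective on families of maps x |-> A x + v. The measure is 0 if [F] is
   empty. *)
Definition is_regular_measure_on_family (F : set {compact-open, H -> H}) mu :=
  regular_measure mu /\ mu (~` translation_parts F) = 0.

(* Inner regularity is only required on open sets, as a Haar measure is in
   general infinite. *)
Record is_haar_measure theta : Prop := IsHaarMeasure {
  haar_nonzero : theta [set: H] != 0 ;
  haar_compact : forall K : set H, compact K -> theta K < +oo ;
  haar_outer_regular : forall B : set (borel H), measurable B ->
    outer_regular_at theta B ;
  haar_inner_regular : forall U : set H, open U -> inner_regular_at theta U ;
  haar_invariant : forall (x : H) (B : set (borel H)), measurable B ->
    theta [set (x + y)%R | y in (B : set H)] = theta B
}.

Definition is_modulus theta (Ainv : H -> H) (alpha : R) :=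
  (0 < alpha)%R /\
  forall B : set (borel H), measurable B ->
    theta (Ainv @` B) = alpha%:E * theta B.

Definition density theta (f : H -> R) (B : set (borel H)) : \bar R :=
  \int[theta]_(x in B) (f x)%:E.

Definition nonneg_L1 theta (f : H -> R) :=
  f \in Lfun theta 1 /\ {ae theta, forall x, (0 <= f x)%R}.

(* Support of the class of [f] modulo null sets, i.e. the support of the
   measure with density [`|f|]. *)
Definition ess_supp theta (f : H -> R) : set H :=
  [set x | forall U : set H, open U -> U x ->
             theta (U `&` [set y | f y != 0%R]) != 0].

Definition cvg_L1 n theta (f : nat -> 'cV[H -> R]_n) (g : 'cV[H -> R]_n) :=
  forall i,
    'N[theta]_1[EFin \o (f l i ord0 \- g i ord0)%R] @[l --> \oo] --> 0.

End borel_measures.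

Section convolution.
Context {R : realType} {H : topologicalZmodType} (n : nat).
Variable theta : {measure set (borel H) -> \bar R}.

Definition convol (f g : H -> R) : H -> R :=
  fun x => \int[theta]_v (f (x - v) * g v).

Definition mconv (a b : 'M[H -> R]_n) : 'M[H -> R]_n :=
  \matrix_(i, j) (fun x => \sum_k convol (a i k) (b k j) x).

(* a_0 * a_1 * ... * a_l *)
Fixpoint mconv_iter (a : nat -> 'M[H -> R]_n) (l : nat) : 'M[H -> R]_n :=
  if l is l'.+1 then mconv (mconv_iter a l') (a l) else a 0%N.

(* alpha^k (A^k.h) *)
Definition scaled_density (alpha : R) (Ainv : H -> H) (h : 'M[H -> R]_n)
    (k : nat) : 'M[H -> R]_n :=
  \matrix_(i, j) (fun x => alpha ^+ k * h i j (iter k Ainv x)).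

(* [partial_density alpha Ainv h m l] is the vector f^(l+1), the product of
   the matrix mconv_iter _ l (factors k = 0, ..., l) with the vector m. *)
Definition partial_density (alpha : R) (Ainv : H -> H) (h : 'M[H -> R]_n)
    (m : 'cV[R]_n) (l : nat) : 'cV[H -> R]_n :=
  \col_i (fun x =>
    \sum_j mconv_iter (scaled_density alpha Ainv h) l i j x * m j 0).

End convolution.

Section total_variation.
Context {d : measure_display} {T : measurableType d} {R : realType}.
Local Open Scope ereal_scope.

(* |nu|(T); the value does not depend on the Hahn decomposition chosen. *)
Definition tv_norm (nu : {charge set T -> \bar R}) : \bar R :=
  let: exist P hP := cid (Hahn_decomposition nu) in
  let: exist N nuPN := cid hP in
  charge_variation nuPN [set: T].

Definition tv_cvg (mu : nat -> {finite_measure set T -> \bar R}) :=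
  exists nu : {charge set T -> \bar R},
    tv_norm (cadd (charge_of_finite_measure (mu l)) (copp nu))
      @[l --> \oo] --> 0.

(* Values on measurable rectangles determine a finite measure. *)
Definition is_product_measure n (mu : 'I_n -> set T -> \bar R)
    (omega : {measure set (n.-tuple T) -> \bar R}) :=
  forall B : 'I_n -> set T, (forall i, measurable (B i)) ->
    omega [set t | forall i, B i (tnth t i)] = \prod_(i < n) mu i (B i).

End total_variation.

(* Main.v *)
(** Evaluated on cylinders over the [i]-th coordinate, the limit charge of the
[omega^(l)] is absolutely continuous; up to the factor [\prod_(j != i) m_j] its
Radon-Nikodym density is the L1 limit [g_i] of [f_i^(l)].  By associativity of convolution
and compatibility of [f |-> alpha * f o A^-1] with it, the convolution products
can be peeled off on the left, [f^(l+1) = h * (alpha A.f^(l))]; Young's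
inequality [|h * u|_1 <= |h|_1 |u|_1] passes this to the limit and yields the
fixed-point equation.  Since [h_ij] vanishes off [F_ij(0)] and [A] contracts by
[q < 1], [f_i^(l)] lives within distance [c q^l] of [W_i], whence
[supp g_i \subset W_i].  Uniqueness is uniqueness of L1 limits, and for bounded
[h] continuity of [h * u] follows from continuity of translation in L1.
Contractivity of [A] makes the locally compact [H] sigma-compact and second
countable, which is what makes subtraction jointly Borel measurable and [theta]
sigma-finite, so that Tonelli's theorem applies. *)
Require Import Defs.
From HB Require Import structures.
From mathcomp Require Import all_boot all_order all_algebra.
From mathcomp Require Import finmap lra measurable_realfun ess_sup_inf.
From mathcomp Require Import all_classical all_reals all_analysis.
Set Implicit Arguments.
Unset Strict Implicit.
Unset Printing Implicit Defensive.
Import Order.TTheory GRing.Theory Num.Theory.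
Import numFieldNormedType.Exports.
Local Open Scope classical_set_scope.
Local Open Scope ring_scope.

(** The obstacle is that [convol] is a real-valued integral with default value 0 where the integral
    diverges, so its algebraic laws can fail at exceptional points. All algebra is therefore done
    with the [\bar R]-valued [econv] on nonnegative measurable functions, where Tonelli gives every
    identity at every point; finiteness of the total masses carries the results back to real
    functions almost everywhere. Two devices make this work. At a fixed [x], the value
    [convol f g x] must be insensitive to null sets; as [f] is evaluated at [x - v], null sets have
    to be stable under reflection ([ae_reflect]). This allows [h] to be replaced by representatives
    [p] whose supports can be traced without exceptional sets. Limits are taken by dominating a
    quantity that should vanish by measurable functions whose integrals tend to 0
    ([ae0_of_L1_bounds]), which applies to the right-hand side of the fixed-point equation as it
    stands. Strict positivity of [m] enters where a marginal is read off from [omega]: the masses of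
    the other factors are divided out. *)

Lemma countable_bigcup_measurable d (T : sigmaRingType d) (I : choiceType)
    (D : set I) (F : I -> set T) : countable D ->
  (forall i, D i -> measurable (F i)) -> measurable (\bigcup_(i in D) F i).
Proof.
move=> /countable_injP[f finj] mF.
(* Regrouped along the injection [f], the piece of index [k] is empty or a single [F i]. *)
rewrite (_ : \bigcup_(i in D) F i =
    \bigcup_k \bigcup_(i in D `&` f @^-1` [set k]) F i); last first.
  apply/seteqP; split=> [x [i Di Fi]|x [_ _ [i [Di _] Fi]]]; last by exists i.
  by exists (f i) => //; exists i.
apply: bigcupT_measurable => k.
have [->|/set0P[i [Di fi]]] := eqVneq (D `&` f @^-1` [set k]) set0.
  by rewrite bigcup_set0.
rewrite (_ : D `&` _ = [set i]) ?bigcup_set1; first exact: mF.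
apply/seteqP; split=> [j [Dj fj]|j ->//]; apply: finj; rewrite ?inE//.
by rewrite (_ : f j = k)// (_ : f i = k).
Qed.

(** * Borel sets and contractive automorphisms *)

Section borel_sigma_algebra.
Context {H : topologicalZmodType}.

Lemma open_measurable_borel (U : set H) : open U -> measurable (U : set (borel H)).
Proof. by move=> oU; exact: sub_sigma_algebra. Qed.

Lemma closed_measurable_borel (C : set H) : closed C -> measurable (C : set (borel H)).
Proof.
move=> /closed_openC /open_measurable_borel /measurableC.
by rewrite setCK.
Qed.

Lemma continuous_measurable_borel (f : H -> H) : continuous f ->
  measurable_fun [set: borel H] (f : borel H -> borel H).
Proof.
move=> cf; apply: (@measurability _ _ (borel H) (borel H) setT f (@open H) erefl) => _ [U oU <-].
rewrite setTI; apply: open_measurable_borel.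
by apply: open_comp oU => x _; exact: cf.
Qed.

End borel_sigma_algebra.

Section invariant_metric.
Context {R : realType} {H : topologicalZmodType} {dist : H -> H -> R}.
Hypothesis dist_H : invariant_complete_metric dist.

Local Notation dball x e := [set y : H | dist x y < e].

Lemma distxx x : dist x x = 0.
Proof. exact/(dist_eq0 dist_H). Qed.

Lemma dist_ge0 x y : 0 <= dist x y.
Proof.
have := dist_triangle dist_H y x x.
by rewrite distxx (dist_sym dist_H y x); lra.
Qed.

Lemma distD2r x y z : dist (x + z) (y + z) = dist x y.
Proof. exact: dist_invariant dist_H _ _ _. Qed.

Lemma distD2l x y z : dist (z + x) (z + y) = dist x y.
Proof. by rewrite !(addrC z) distD2r. Qed.

Lemma distDl x y : dist x (x + y) = dist 0 y.
Proof. by rewrite -{1}(addr0 x) distD2l. Qed.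

Lemma nbhs_distP x (B : set H) :
  nbhs x B <-> exists2 e : R, 0 < e & dball x e `<=` B.
Proof. by rewrite (dist_nbhs dist_H). Qed.

Lemma open_dball x e : open (dball x e).
Proof.
rewrite openE => y /= xye; rewrite /interior; apply/nbhs_distP.
exists (e - dist x y); first by rewrite subr_gt0.
move=> z /=; rewrite ltrBrDl; apply: le_lt_trans.
exact: dist_triangle dist_H _ _ _.
Qed.

Lemma dist_hausdorff : hausdorff_space H.
Proof.
rewrite open_hausdorff => x y xy.
have d0 : 0 < dist x y.
  by rewrite lt_def dist_ge0 andbT; apply: contra_neq xy => /(dist_eq0 dist_H).
exists (dball x (dist x y / 2), dball y (dist x y / 2)) => /=.
  by split; rewrite inE /= distxx divr_gt0.
split; [exact: open_dball|exact: open_dball|].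
apply/eqP/seteqP; split=> // z [/= xz yz].
have := dist_triangle dist_H z x y.
by rewrite leNgt (dist_sym dist_H z y) [ltRHS]splitr ltrD.
Qed.

Lemma compact_measurable_borel (K : set H) :
  compact K -> measurable (K : set (borel H)).
Proof.
by move=> cK; apply: closed_measurable_borel; apply: compact_closed => //;
  exact: dist_hausdorff.
Qed.

(** The constant in [contractive] may be negative when [H] is trivial; the geometric estimates with
    [q ^+ k] require [0 <= q]. *)
Lemma contractiveW (f : H -> H) : contractive dist f ->
  exists2 q : R, 0 <= q < 1 & forall x y : H, dist (f x) (f y) <= q * dist x y.
Proof.
move=> [q q1 fq]; exists (Num.max q 0).
  by rewrite le_max lexx orbT gt_max q1 ltr01.
by move=> x y; rewrite (le_trans (fq x y))// ler_wpM2r ?dist_ge0// le_max lexx.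
Qed.

Lemma dist_iter0 (f : {additive H -> H}) (q : R) : 0 <= q ->
  (forall x y, dist (f x) (f y) <= q * dist x y) ->
  forall k x, dist 0 (iter k f x) <= q ^+ k * dist 0 x.
Proof.
move=> q0 fq; elim=> [|k IH] x; first by rewrite expr0 mul1r.
rewrite iterS -{1}(raddf0 f) (le_trans (fq _ _))//.
by rewrite exprS -mulrA ler_wpM2l.
Qed.

(** * Sigma-compactness and second countability from the contraction *)

Section sigma_compactness.
Context {A : {additive H -> H}} {Ainv : H -> H}.
Hypothesis Hlc : locally_compact [set: H].
Hypothesis A_aut : is_automorphism A Ainv.
Hypothesis A_contr : contractive dist A.

(** The iterates of [A] carry every point into a compact neighbourhood [B] of 0, so the images of
    [B] under the iterates of [Ainv] exhaust [H]. *)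
Lemma exists_compact_cover :
  exists2 K : nat -> set H, (forall k, compact (K k)) & \bigcup_k K k = setT.
Proof.
have [AK AinvK cA cAinv] := A_aut.
have [q /andP[q0 q1] Aq] := contractiveW A_contr.
have [B + [cB _]] : compact_near (within setT (nbhs (0 : H))) by exact: Hlc.
move=> nB; have B0 : nbhs (0 : H) B.
  by move: nB; rewrite /within/=; apply: filterS => x; exact.
exists (fun k => iter k Ainv @` B).
  move=> k; apply: continuous_compact => //; apply: continuous_subspaceT.
  elim: k => [|k IH] x; first exact: cvg_id.
  by apply: (@continuous_comp _ _ _ (iter k Ainv) Ainv); [exact: IH|exact: cAinv].
apply/seteqP; split=> // x _.
have [e e0 eB] := (nbhs_distP 0 B).1 B0.
have : (q ^+ k * dist 0 x) @[k --> \oo] --> 0.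
  rewrite -(mul0r (dist 0 x)); apply: cvgM; last exact: cvg_cst.
  by apply: cvg_expr; rewrite ger0_norm.
move=> /cvgr_lt /(_ _ e0) [k _ /(_ k (leqnn k)) ke].
exists k => //; exists (iter k A x).
  by apply: eB => /=; apply: le_lt_trans ke; exact: dist_iter0 q0 Aq _ _.
elim: k x {ke} => // k IH x.
by rewrite iterSr iterS AK IH.
Qed.

(** Each compact piece is covered by finitely many balls of radius [1/(i+1)]; [D] collects their
    centres over all pieces and all [i]. *)
Lemma exists_countable_dense : exists2 D : set H, countable D &
  forall x (e : R), 0 < e -> exists2 d, D d & dist d x < e.
Proof.
have [K cK KT] := exists_compact_cover.
have cover k i : exists D : {fset H},
    K k `<=` \bigcup_(d in [set` D]) dball d i.+1%:R^-1.
  pose Hp : ptopologicalType := HB.pack H (isPointed.Build H 0).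
  have : @cover_compact Hp (K k) by rewrite -compact_cover; exact: cK.
  move=> /(_ _ setT (fun d => dball d i.+1%:R^-1)) [d _| |D _ KD].
  - exact: open_dball.
  - by move=> x _; exists x => //=; rewrite distxx invr_gt0.
  - by exists D.
pose D (p : nat * nat) := sval (cid (cover p.1 p.2)).
exists (\bigcup_p [set` D p]).
  apply: bigcup_countable; first exact: countableP.
  by move=> p _; exact/finite_set_countable/finite_fset.
move=> x e e0; have : (\bigcup_k K k) x by rewrite KT.
move=> [k _ Kx]; have [i ie] : exists i, i.+1%:R^-1 < e.
  by exists (Num.truncn e^-1); rewrite invf_plt ?posrE// truncnS_gt.
have [d Dd /= dx] := svalP (cid (cover k i)) x Kx.
by exists d; [exists (k, i)|exact: lt_trans dx ie].
Qed.

(** Measurability refers to the product sigma-algebra, so the preimage of an open set has to be a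
    countable union of rectangles. Products of balls with centres in the countable dense set and
    radii [1/(k+1)] provide them. *)
Lemma measurable_subr :
  measurable_fun [set: borel H * borel H]
    (fun p : borel H * borel H => (p.1 : H) - p.2 : borel H).
Proof.
have [D cD dD] := exists_countable_dense.
apply: (@measurability _ _ (borel H * borel H)%type (borel H) setT _ (@open H) erefl).
move=> _ [U oU <-]; rewrite setTI.
rewrite [X in measurable X](_ : _ =
  \bigcup_(c in D `*` D `*` [set: nat] `&`
    [set c : H * H * nat | forall x y : H,
       dist c.1.1 x < c.2.+1%:R^-1 -> dist c.1.2 y < c.2.+1%:R^-1 -> U (x - y)])
  (dball c.1.1 c.2.+1%:R^-1 `*` dball c.1.2 c.2.+1%:R^-1)); last first.
  apply/seteqP; split=> [[x y]/= Uxy|[x y] [[[a b] k] [_ /= abU] [/= ax bY]]]; last first.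
    exact: abU.
  have /nbhs_distP[e e0 eU] : nbhs (x - y) U by exact: open_nbhs_nbhs.
  (* Two points of one ball are less than two radii apart, so the two coordinates together move the
     difference by less than four radii. *)
  have [i ie] : exists i, i.+1%:R^-1 < e / 4.
    by exists (Num.truncn (e / 4)^-1); rewrite invf_plt ?posrE ?divr_gt0// truncnS_gt.
  have i0 : 0 < i.+1%:R^-1 :> R by rewrite invr_gt0.
  have [a Da ax] := dD x _ i0; have [b Db bY] := dD y _ i0.
  exists (a, b, i) => //=; split=> //= x' y' ax' by'.
  apply: eU => /=.
  (* Translating by [y + y'] turns the differences into sums, to which invariance applies one
     coordinate at a time. *)
  have -> : dist (x - y) (x' - y') = dist (x + y') (x' + y).
    rewrite -(distD2r (x - y) _ (y + y')); congr dist.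
      by rewrite addrA subrK.
    by rewrite (addrC y) addrA subrK.
  have H1 := dist_triangle dist_H (x' + y') (x + y') (x' + y).
  rewrite distD2r distD2l in H1.
  have H2 := dist_triangle dist_H a x x'.
  have H3 := dist_triangle dist_H b y' y.
  rewrite (dist_sym dist_H x a) in H2; rewrite (dist_sym dist_H y' b) in H3.
  by move: (i.+1%:R^-1) ie i0 ax bY ax' by' => u *; lra.
apply: countable_bigcup_measurable.
  apply: sub_countable (countableX (countableX cD cD) (@countableP nat setT)).
  by apply: subset_card_le; exact: subIsetl.
move=> [[a b] k] _; apply: measurableX; apply: open_measurable_borel;
  exact: open_dball.
Qed.

Lemma haar_sigma_finite (theta : {measure set (borel H) -> \bar R}) :
  is_haar_measure theta -> sigma_finite [set: borel H] theta.
Proof.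
move=> haar; have [K cK KT] := exists_compact_cover.
exists K; first by rewrite -KT.
by move=> k; split; [exact: compact_measurable_borel|exact: haar_compact haar _ _].
Qed.
End sigma_compactness.
End invariant_metric.

(** * Convolution of nonnegative functions *)

Section ereal_convolution.
Context {R : realType} {H : topologicalZmodType}.
Variable theta : {sigma_finite_measure set (borel H) -> \bar R}.
Local Notation X := (borel H).
Hypothesis subr_meas :
  measurable_fun [set: X * X] (fun p : X * X => (p.1 : H) - p.2 : X).
Hypothesis theta_inv : forall (x : H) (B : set X), measurable B ->
  theta [set x + y | y in (B : set H)] = theta B.
Hypothesis theta_neq0 : theta [set: X] != 0%E.
Local Open Scope ereal_scope.

Definition ge0_meas (f : H -> \bar R) :=
  measurable_fun [set: X] (f : X -> \bar R) /\ forall x, 0 <= f x.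

(** With values in [\bar R] the integral of nonnegative measurable functions always makes sense, so
    the laws below hold at every point and without integrability conditions. *)
Definition econv (f g : H -> \bar R) (x : H) : \bar R :=
  \int[theta]_(v in [set: X]) (f (x - v)%R * g v).

Lemma measurable_shift (c : H) : measurable_fun [set: X] (fun x : X => (x + c)%R : X).
Proof.
have := measurableT_comp subr_meas (@pair2_measurable _ _ X X (- c)%R).
by apply: eq_measurable_fun => x _ /=; rewrite opprK.
Qed.

Lemma measurable_reflect (c : H) : measurable_fun [set: X] (fun x : X => (c - x)%R : X).
Proof. exact: measurableT_comp subr_meas (@pair1_measurable _ _ X X c). Qed.

Lemma preimage_shift (c : H) (B : set H) :
  (fun x => x + c)%R @^-1` B = [set (- c + y)%R | y in B].
Proof.
apply/seteqP; split=> [x /= Bx|_ [y By <-]] /=; last by rewrite addrAC addNr add0r.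
by exists (x + c)%R => //; rewrite addrC addrK.
Qed.

Lemma ge0_integral_shift (f : H -> \bar R) (c : H) : ge0_meas f ->
  \int[theta]_(x in [set: X]) f (x + c)%R = \int[theta]_(x in [set: X]) f x.
Proof.
move=> [mf f0].
rewrite [RHS](@eq_measure_integral _ _ _ setT (pushforward theta (fun x : X => (x + c)%R : X))).
- exact: measurable_shift.
- by move=> ms; rewrite ge0_integral_pushforward.
move=> ms B mB _; have := theta_inv (- c)%R mB.
by rewrite -preimage_shift => E; exact: esym E.
Qed.

Lemma ge0_meas_sub (f : H -> \bar R) : ge0_meas f ->
  measurable_fun [set: X * X] (fun p : X * X => f ((p.1 : H) - p.2)%R).
Proof. by move=> [mf _]; exact: (measurableT_comp mf subr_meas). Qed.

Lemma ge0_meas_shift (f : H -> \bar R) c : ge0_meas f -> ge0_meas (fun x => f (x + c)%R).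
Proof.
by move=> [mf f0]; split=> //; exact: (measurableT_comp mf (measurable_shift c)).
Qed.

Lemma ge0_meas_reflect (f : H -> \bar R) c : ge0_meas f -> ge0_meas (fun x => f (c - x)%R).
Proof.
by move=> [mf f0]; split=> //; exact: (measurableT_comp mf (measurable_reflect c)).
Qed.

Lemma ge0_measM (f g : H -> \bar R) : ge0_meas f -> ge0_meas g ->
  ge0_meas (fun x => f x * g x).
Proof.
move=> [mf f0] [mg g0]; split; first exact: emeasurable_funM.
by move=> x; exact: mule_ge0.
Qed.

Lemma ge0_meas_sum (I : finType) (f : I -> H -> \bar R) :
  (forall i, ge0_meas (f i)) -> ge0_meas (fun x => \sum_i f i x).
Proof.
move=> mf; split; last by move=> x; apply: sume_ge0 => i _; apply (mf i).2.
by apply: emeasurable_sum => i; apply (mf i).1.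
Qed.

Lemma ge0_measZ (c : \bar R) (f : H -> \bar R) : 0 <= c -> ge0_meas f ->
  ge0_meas (fun x => c * f x).
Proof. by move=> c0; apply: ge0_measM; split=> //; exact: measurable_cst. Qed.

Lemma measurable_econv_kernel (f g : H -> \bar R) : ge0_meas f -> ge0_meas g ->
  measurable_fun [set: X * X] (fun p : X * X => f ((p.1 : H) - p.2)%R * g p.2).
Proof.
move=> mf mg; apply: emeasurable_funM; first exact: ge0_meas_sub.
exact: (measurableT_comp mg.1 measurable_snd).
Qed.

Lemma ge0_meas_econv (f g : H -> \bar R) : ge0_meas f -> ge0_meas g ->
  ge0_meas (econv f g).
Proof.
move=> mf mg; split; last first.
  by move=> x; apply: integral_ge0 => v _; rewrite mule_ge0 ?mf.2 ?mg.2.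
apply: (measurable_fun_fubini_tonelli_F (fun p : X * X => f ((p.1 : H) - p.2)%R * g p.2)).
  exact: measurable_econv_kernel.
by move=> x; rewrite mule_ge0 ?mf.2 ?mg.2.
Qed.

(** Young's inequality becomes an equality because nothing cancels: Tonelli, then translation
    invariance of the inner integral. *)
Lemma integral_econv (f g : H -> \bar R) : ge0_meas f -> ge0_meas g ->
  \int[theta]_(x in [set: X]) econv f g x =
  \int[theta]_(x in [set: X]) f x * \int[theta]_(x in [set: X]) g x.
Proof.
move=> mf mg.
rewrite (fubini_tonelli (fun p : X * X => f ((p.1 : H) - p.2)%R * g p.2)); first last.
- by move=> x; rewrite mule_ge0 ?mf.2 ?mg.2.
- exact: measurable_econv_kernel.
rewrite -ge0_integralZl//; first last.
- by apply: integral_ge0 => x _; exact: mf.2.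
- by move=> x _; exact: mg.2.
- exact: mg.1.
apply: eq_integral => v _ /=.
rewrite ge0_integralZr ?mg.2//; first by rewrite (ge0_integral_shift _ mf).
- exact: (ge0_meas_shift (- v)%R mf).1.
- by move=> x _; exact: mf.2.
Qed.

(** The substitution [v = u - w] in the inner integral makes both sides iterated integrals of one
    function of [(u, w)]; Tonelli exchanges the order. *)
Lemma econvA (f g k : H -> \bar R) : ge0_meas f -> ge0_meas g -> ge0_meas k ->
  econv (econv f g) k =1 econv f (econv g k).
Proof.
move=> mf mg mk x; rewrite /econv.
transitivity (\int[theta]_(w in [set: X]) \int[theta]_(u in [set: X])
    (f (x - u)%R * (g (u - w)%R * k w))).
  apply: eq_integral => w _.
  rewrite -ge0_integralZr ?mk.2//; first last.
  - by move=> v _; rewrite mule_ge0 ?mf.2 ?mg.2.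
  - by apply (ge0_measM (ge0_meas_reflect _ mf) mg).
  rewrite -(@ge0_integral_shift (fun v => f (x - w - v)%R * g v * k w) (- w)%R).
    apply: eq_integral => u _; rewrite -muleA; congr (f _ * _).
    by rewrite opprB addrA subrK.
  have mkw : ge0_meas (fun=> k w).
    by split=> [|_]; [exact: measurable_cst|exact: mk.2].
  exact: (ge0_measM (ge0_measM (ge0_meas_reflect _ mf) mg) mkw).
rewrite -(fubini_tonelli (fun p : X * X => f (x - p.1)%R * (g ((p.1 : H) - p.2)%R * k p.2))); first last.
- by move=> p; rewrite !mule_ge0 ?mf.2 ?mg.2 ?mk.2.
- apply: emeasurable_funM; last exact: measurable_econv_kernel.
  exact: (measurableT_comp (ge0_meas_reflect x mf).1 measurable_fst).
apply: eq_integral => u _ /=.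
rewrite ge0_integralZl ?mf.2//.
- by apply (ge0_measM (ge0_meas_reflect _ mg) mk).
- by move=> w _; rewrite mule_ge0 ?mg.2 ?mk.2.
Qed.

Lemma econv_suml (I : finType) (f : I -> H -> \bar R) (g : H -> \bar R) :
  (forall i, ge0_meas (f i)) -> ge0_meas g ->
  econv (fun x => \sum_i f i x) g =1 fun x => \sum_i econv (f i) g x.
Proof.
move=> mf mg x; rewrite /econv -ge0_integral_sum//; first last.
- by move=> i v _; rewrite mule_ge0 ?(mf i).2 ?mg.2.
- by move=> i; apply (ge0_measM (ge0_meas_reflect x (mf i)) mg).
apply: eq_integral => v _; rewrite ge0_sume_distrl// => i _.
exact: (mf i).2.
Qed.

Lemma econv_sumr (I : finType) (f : H -> \bar R) (g : I -> H -> \bar R) :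
  ge0_meas f -> (forall i, ge0_meas (g i)) ->
  econv f (fun x => \sum_i g i x) =1 fun x => \sum_i econv f (g i) x.
Proof.
move=> mf mg x; rewrite /econv -ge0_integral_sum//; first last.
- by move=> i v _; rewrite mule_ge0 ?(mg i).2 ?mf.2.
- by move=> i; apply (ge0_measM (ge0_meas_reflect x mf) (mg i)).
apply: eq_integral => v _; rewrite ge0_sume_distrr// => i _.
exact: (mg i).2.
Qed.

Lemma econvZr (f g : H -> \bar R) (c : \bar R) : 0 <= c -> ge0_meas f -> ge0_meas g ->
  econv f (fun x => g x * c) =1 fun x => econv f g x * c.
Proof.
move=> c0 mf mg x; rewrite /econv -ge0_integralZr//; first last.
- by move=> v _; rewrite mule_ge0 ?mf.2 ?mg.2.
- by apply (ge0_measM (ge0_meas_reflect x mf) mg).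
by apply: eq_integral => v _; rewrite muleA.
Qed.

(* Fubini applied to the indicator of [x - v \in N] replaces the reflection
   invariance of [theta]. *)
Lemma ae_reflect (P : H -> Prop) (x : H) :
  {ae theta, forall v : X, P v} -> {ae theta, forall v : X, P (x - v)%R}.
Proof.
move=> [N [mN N0 PN]].
have mi : ge0_meas (fun x => (\1_N x)%:E).
  by split; [exact/measurable_EFinP/measurable_indic|move=> y; rewrite lee_fin].
have m1 : ge0_meas (cst 1) by split=> //; exact: measurable_cst.
have refl_x y : econv (fun x => (\1_N x)%:E) (cst 1) y =
    theta ((fun v : H => y - v)%R @^-1` N).
  rewrite /econv; under eq_integral do rewrite mule1.
  have mR : measurable ((fun v : X => (y - v)%R : X) @^-1` N).
    by rewrite -[X in measurable X]setTI; exact: measurable_reflect.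
  rewrite (eq_integral (fun v => (\1_((fun v : X => (y - v)%R : X) @^-1` N) v)%:E))//.
  by rewrite integral_indic// setIT.
(* By [integral_econv] this is [theta N * theta setT], which is 0 even if [theta setT] is
   infinite. *)
have : \int[theta]_(y in [set: X]) `|econv (fun x => (\1_N x)%:E) (cst 1) y| = 0.
  under eq_integral do rewrite gee0_abs ?(ge0_meas_econv mi m1).2//.
  have iN : \int[theta]_(y in [set: X]) (\1_N y)%:E = 0.
    by rewrite integral_indic// setIT.
  by rewrite integral_econv// iN mul0e.
move=> /ae_eq_integral_abs => /(_ measurableT (ge0_meas_econv mi m1).1) [M [mM M0 MP]].
(* Almost every reflection of [N] is null. As [theta] is nonzero, there is at least one such centre
   [x0], and a translation by [x0 - x] passes from it to the given [x]. *)
have [x0 Mx0] : exists x0 : X, ~ M x0.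
  apply/existsNP => MT; move/negP: theta_neq0; apply.
  by rewrite (_ : setT = M) ?M0//; apply/seteqP; split.
have x0N : theta ((fun v : H => x0 - v)%R @^-1` N) = 0.
  by rewrite -refl_x; apply: contrapT => E; apply: Mx0; apply: MP => /= /(_ I).
exists ((fun v : H => x - v)%R @^-1` N); split.
- by rewrite -[X in measurable X]setTI; exact: measurable_reflect.
- rewrite -x0N -(@theta_inv (x0 - x)%R); last first.
    by rewrite -[X in measurable X]setTI; exact: measurable_reflect.
  apply: (congr1 theta); apply/seteqP; split=> [_ [v /= Nv <-]|v /= Nv]; last first.
    exists (v - (x0 - x))%R; last by rewrite addrC subrK.
    by rewrite /= opprB addrA (addrC x) subrK.
  by rewrite opprD addrA subKr.
- by move=> v /= Pv; exact: PN.
Qed.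

Lemma econv_support (f g : H -> \bar R) (x : H) : econv f g x != 0 ->
  exists v, f (x - v)%R != 0 /\ g v != 0.
Proof.
apply: contra_neqP => /forallNP fg; apply: integral0_eq => v _.
have [->|fv] := eqVneq (f (x - v)%R) 0; first by rewrite mul0e.
have [->|gv] := eqVneq (g v) 0; first by rewrite mule0.
by case: (fg v).
Qed.

(** * Transport of densities by the automorphism *)

Section modulus.
Context {A : {additive H -> H}} {Ainv : H -> H} {alpha : R}.
Hypothesis A_aut : is_automorphism A Ainv.
Hypothesis A_mod : is_modulus theta Ainv alpha.

(** The density of the push-forward under [A] of the measure with density [f]; this is why it
    preserves mass and respects convolution. *)
Definition escale (f : H -> \bar R) (x : H) : \bar R := alpha%:E * f (Ainv x).

Lemma ge0_meas_comp_Ainv (f : H -> \bar R) : ge0_meas f -> ge0_meas (f \o Ainv).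
Proof.
move=> [mf f0]; split=> [|x]; last exact: f0.
apply: (measurableT_comp mf); apply: continuous_measurable_borel.
by have [] := A_aut.
Qed.

Lemma alpha_ge0 : (0 <= alpha)%R. Proof. exact/ltW/A_mod.1. Qed.

Lemma ge0_meas_escale (f : H -> \bar R) : ge0_meas f -> ge0_meas (escale f).
Proof.
by move=> mf; apply: ge0_measZ; [rewrite lee_fin alpha_ge0|exact: ge0_meas_comp_Ainv].
Qed.

Lemma integral_escale (f : H -> \bar R) : ge0_meas f ->
  \int[theta]_(x in [set: X]) escale f x = \int[theta]_(x in [set: X]) f x.
Proof.
move=> mf; have [AK AinvK cA cAinv] := A_aut.
have mA : measurable_fun [set: X] (A : X -> X) by exact: continuous_measurable_borel.
have [mfA fA0] := ge0_meas_comp_Ainv mf.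
have -> : \int[theta]_(x in [set: X]) f x =
    \int[pushforward theta (A : X -> X)]_(x in [set: X]) f (Ainv x).
  rewrite (@ge0_integral_pushforward _ _ X X R A mA theta setT (f \o Ainv))//.
  by rewrite preimage_setT; apply: eq_integral => x _ /=; rewrite AK.
rewrite [RHS](@eq_measure_integral _ _ _ setT (mscale (NngNum alpha_ge0) theta)).
  rewrite ge0_integral_mscale//; last by move=> x _; exact: fA0.
  apply: (ge0_integralZl theta measurableT mfA); last by rewrite lee_fin alpha_ge0.
  by move=> x _; exact: fA0.
move=> B mB _; apply: etrans (A_mod.2 B mB); apply: (congr1 theta).
apply/seteqP; split=> [x /= Bx|_ [x Bx <-]] /=; last by rewrite AinvK.
by exists (A x) => //; rewrite AK.
Qed.

Lemma AinvB (x y : H) : Ainv (x - y)%R = (Ainv x - Ainv y)%R.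
Proof.
have [AK AinvK _ _] := A_aut.
by apply: (can_inj AK); rewrite raddfB !AinvK.
Qed.

(** Of the two factors [alpha] on the right, one is the prefactor on the left and the other is the
    Jacobian of replacing [v] by [Ainv v]. *)
Lemma econv_escale (f g : H -> \bar R) : ge0_meas f -> ge0_meas g ->
  escale (econv f g) =1 econv (escale f) (escale g).
Proof.
move=> mf mg x; rewrite /escale /econv -ge0_integralZl//; first last.
- by rewrite lee_fin alpha_ge0.
- by move=> v _; rewrite mule_ge0 ?mf.2 ?mg.2.
- by apply (ge0_measM (ge0_meas_reflect _ mf) mg).
rewrite -(@integral_escale (fun v => alpha%:E * (f (Ainv x - v)%R * g v))); last first.
  have a0 : 0 <= alpha%:E by rewrite lee_fin alpha_ge0.
  exact: (ge0_measZ a0 (ge0_measM (ge0_meas_reflect _ mf) mg)).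
apply: eq_integral => v _; rewrite /escale AinvB.
by rewrite muleA [LHS]muleA [RHS]muleA; congr (_ * _); rewrite muleAC.
Qed.

End modulus.
End ereal_convolution.

(** * Iterated densities *)

Section density_iteration.
Context {R : realType} {H : topologicalZmodType}.
Variable theta : {sigma_finite_measure set (borel H) -> \bar R}.
Local Notation X := (borel H).
Hypothesis subr_meas :
  measurable_fun [set: X * X] (fun p : X * X => (p.1 : H) - p.2 : X).
Hypothesis theta_inv : forall (x : H) (B : set X), measurable B ->
  theta [set x + y | y in (B : set H)] = theta B.
Hypothesis theta_neq0 : theta [set: X] != 0%E.
Context {A : {additive H -> H}} {Ainv : H -> H} {alpha : R}.
Hypothesis A_aut : is_automorphism A Ainv.
Hypothesis A_mod : is_modulus theta Ainv alpha.
Context {n : nat} {m : 'cV[R]_n} {p : 'I_n -> 'I_n -> H -> \bar R}.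
Hypothesis m_gt0 : forall i, 0 < m i 0.
Hypothesis p_meas : forall i j, ge0_meas (p i j).
Local Open Scope ereal_scope.
Local Notation S := (@escale R H Ainv alpha).
Local Notation conv := (econv theta).

(** The counterpart of [mconv_iter] for the scaled densities, built from [p] and with values in
    [\bar R]; [mconv_iter_emconv_iter] compares the two. *)
Fixpoint emconv_iter (l : nat) (i j : 'I_n) : H -> \bar R :=
  if l is l'.+1 then fun x => \sum_k conv (emconv_iter l' i k) (iter l S (p k j)) x
  else p i j.

Definition edensity (l : nat) (i : 'I_n) (x : H) : \bar R :=
  \sum_j emconv_iter l i j x * (m j 0)%:E.

Lemma ge0_meas_iter_escale l (f : H -> \bar R) : ge0_meas f -> ge0_meas (iter l S f).
Proof. by move=> mf; elim: l => // l IH; exact: ge0_meas_escale A_aut A_mod _ IH. Qed.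

Lemma ge0_meas_emconv_iter l i j : ge0_meas (emconv_iter l i j).
Proof.
elim: l i j => [|l IH] i j /=; first exact: p_meas.
apply: ge0_meas_sum => k; apply: ge0_meas_econv => //.
exact: (@ge0_meas_iter_escale l.+1).
Qed.

Lemma ge0_meas_edensity l i : ge0_meas (edensity l i).
Proof.
apply: ge0_meas_sum => j; apply: ge0_measM; first exact: ge0_meas_emconv_iter.
by split=> [|_]; [exact: measurable_cst|rewrite lee_fin ltW].
Qed.

Lemma escale_sum (I : finType) (f : I -> H -> \bar R) :
  (forall i, ge0_meas (f i)) -> S (fun x => \sum_i f i x) = fun x => \sum_i S (f i) x.
Proof.
move=> mf; apply/funext => x; rewrite /escale ge0_sume_distrr// => i _.
exact: (mf i).2.
Qed.

(* The product can be peeled off on the left: [P_{l+1} = p * S P_l]. *)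
Lemma emconv_iterS l i j :
  emconv_iter l.+1 i j = fun x => \sum_k conv (p i k) (S (emconv_iter l k j)) x.
Proof.
have mS f : ge0_meas f -> ge0_meas (S f) by exact: ge0_meas_escale A_aut A_mod _.
elim: l i j => [//|l IH] i j.
apply/funext => x; rewrite [LHS]/=.
transitivity (\sum_k \sum_q
    conv (p i q) (S (conv (emconv_iter l q k) (iter l.+1 S (p k j)))) x).
  apply: eq_bigr => k _; rewrite -[fun x0 => _]/(emconv_iter l.+1 i k) IH.
  rewrite econv_suml//; first last.
  - exact: (@ge0_meas_iter_escale l.+2).
  - by move=> q; apply: ge0_meas_econv => //; apply: mS; exact: ge0_meas_emconv_iter.
  apply: eq_bigr => q _; rewrite econvA//; first last.
  - exact: (@ge0_meas_iter_escale l.+2).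
  - by apply: mS; exact: ge0_meas_emconv_iter.
  (* The last factor [iter l.+2 S] is [S] of [iter l.+1 S], so both factors recombine under a single
     [S]. *)
  congr (conv _ _ x); apply/funext => y.
  rewrite (econv_escale subr_meas A_aut A_mod)//; first exact: ge0_meas_emconv_iter.
  exact: (@ge0_meas_iter_escale l.+1).
rewrite exchange_big; apply: eq_bigr => q _ /=.
rewrite escale_sum; last first.
  move=> k; apply: ge0_meas_econv => //; first exact: ge0_meas_emconv_iter.
  exact: (@ge0_meas_iter_escale l.+1).
rewrite econv_sumr// => k.
apply: mS; apply: ge0_meas_econv => //; first exact: ge0_meas_emconv_iter.
exact: (@ge0_meas_iter_escale l.+1).
Qed.

(** Mass, support and the fixed-point equation are all derived from this left recursion, in which
    the previous density appears as a whole under [S]. *)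
Lemma edensityS l i :
  edensity l.+1 i = fun x => \sum_k conv (p i k) (S (edensity l k)) x.
Proof.
have mS f : ge0_meas f -> ge0_meas (S f) by exact: ge0_meas_escale A_aut A_mod _.
have m0 j : 0 <= (m j 0)%:E by rewrite lee_fin ltW.
have mP k j : ge0_meas (S (emconv_iter l k j)) by apply: mS; exact: ge0_meas_emconv_iter.
apply/funext => x; rewrite [LHS]/edensity.
transitivity (\sum_j \sum_k conv (p i k) (S (emconv_iter l k j)) x * (m j 0)%:E).
  apply: eq_bigr => j _; rewrite emconv_iterS ge0_sume_distrl// => k _.
  by apply (ge0_meas_econv theta subr_meas (p_meas i k) (mP k j)).
rewrite exchange_big; apply: eq_bigr => k _ /=.
rewrite (escale_sum (f := fun j x => emconv_iter l k j x * (m j 0)%:E)); last first.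
  move=> j; apply: ge0_measM; first exact: ge0_meas_emconv_iter.
  by split=> [|_]; [exact: measurable_cst|].
have SZ j : S (fun x => emconv_iter l k j x * (m j 0)%:E) =
    fun x => S (emconv_iter l k j) x * (m j 0)%:E.
  by apply/funext => y; rewrite /escale muleA.
rewrite econv_sumr//.
  by apply: eq_bigr => j _; rewrite SZ econvZr.
move=> j; rewrite SZ; apply: ge0_measM => //.
Qed.

Lemma integral_sum_measurable (I : finType) (f : I -> H -> \bar R) :
  (forall i, ge0_meas (f i)) ->
  \int[theta]_(x in [set: X]) (\sum_i f i x) = \sum_i \int[theta]_(x in [set: X]) f i x.
Proof.
move=> mf; rewrite ge0_integral_sum//.
- by move=> i; exact: (mf i).1.
- by move=> i x _; exact: (mf i).2.
Qed.

(** Passing to masses turns [edensityS] into multiplication by the matrix of masses of [p], which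
    fixes [m]. *)
Lemma integral_edensity :
  (forall i, \sum_k \int[theta]_(x in [set: X]) p i k x * (m k 0)%:E = (m i 0)%:E) ->
  forall l i, \int[theta]_(x in [set: X]) edensity l i x = (m i 0)%:E.
Proof.
have mS f : ge0_meas f -> ge0_meas (S f) by exact: ge0_meas_escale A_aut A_mod _.
have m0 j : 0 <= (m j 0)%:E by rewrite lee_fin ltW.
move=> sm; elim=> [|l IH] i.
  rewrite integral_sum_measurable.
    rewrite -[RHS]sm; apply: eq_bigr => j _ /=.
    rewrite ge0_integralZr//; first exact: (p_meas i j).1.
    by move=> x _; exact: (p_meas i j).2.
  move=> j; apply: ge0_measM; first exact: p_meas.
  by split=> [|_]; [exact: measurable_cst|].
rewrite edensityS integral_sum_measurable.
  rewrite -[RHS]sm; apply: eq_bigr => k _.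
  rewrite integral_econv//; last by apply: mS; exact: ge0_meas_edensity.
  by rewrite (integral_escale A_aut A_mod) ?IH//; exact: ge0_meas_edensity.
by move=> k; apply: ge0_meas_econv => //; apply: mS; exact: ge0_meas_edensity.
Qed.

(** Finite mass makes the iterated convolutions finite almost everywhere, so that [fine] loses
    nothing there. *)
Lemma integral_emconv_iter_lty :
  (forall i j, \int[theta]_(x in [set: X]) p i j x < +oo) ->
  forall l i j, \int[theta]_(x in [set: X]) emconv_iter l i j x < +oo.
Proof.
move=> poo; elim=> [|l IH] i j; first exact: poo.
have iS k i' : \int[theta]_(x in [set: X]) iter k S (p i' j) x = \int[theta]_(x in [set: X]) p i' j x.
  by elim: k => // k IHk; rewrite iterS (integral_escale A_aut A_mod) ?IHk//; exact: ge0_meas_iter_escale.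
rewrite integral_sum_measurable; last first.
  move=> k; apply: ge0_meas_econv => //; first exact: ge0_meas_emconv_iter.
  exact: (@ge0_meas_iter_escale l.+1).
apply: lte_sum_pinfty => k _.
rewrite (integral_econv subr_meas theta_inv)//; first last.
- exact: (@ge0_meas_iter_escale l.+1).
- exact: ge0_meas_emconv_iter.
rewrite (iS l.+1 k); apply: lte_mul_pinfty => //.
  by apply: integral_ge0 => x _; apply (ge0_meas_emconv_iter l i k).2.
rewrite ge0_fin_numE//.
by apply: integral_ge0 => x _; apply (ge0_meas_emconv_iter l i k).2.
Qed.

(** * Location of the supports *)

Section support.
Context {dist : H -> H -> R} {W : 'I_n -> set H} {q c : R}.
Hypothesis dist_H : invariant_complete_metric dist.
Hypothesis q_ge0 : (0 <= q)%R.
Hypothesis A_lip : forall x y, (dist (A x) (A y) <= q * dist x y)%R.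
Hypothesis p_attr : forall i j v w, p i j v != 0 -> W j w -> W i (v + A w)%R.
Hypothesis W_near0 : forall j, exists2 w, W j w & (dist 0 w <= c)%R.

Lemma sum_neq0 (f : 'I_n -> \bar R) : \sum_i f i != 0 -> exists i, f i != 0.
Proof.
apply: contra_neqP => /forallNP f0; apply: big1 => i _.
by apply/eqP/negPn/negP; exact: f0.
Qed.

(** A point [x] of [F_ij(0)] need not lie in [W i], but [x + A w] does for [w] in [W j], at distance
    at most [q * c] if [w] is chosen within [c] of 0. In the induction step [x = (x - v) + v] with
    [Ainv v] close to some [w] in [W k]; the map with translation part [x - v] sends [w] into [W i]
    and shrinks the error by [q]. *)
Lemma edensity_support l i x : edensity l i x != 0 ->
  exists2 w, W i w & (dist x w <= q ^+ l.+1 * c)%R.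
Proof.
have [AK AinvK _ _] := A_aut.
elim: l i x => [|l IH] i x.
  move=> /sum_neq0[j /=]; rewrite mule_eq0 negb_or => /andP[pij _].
  have [w Ww wc] := W_near0 j; exists (x + A w)%R; first exact: p_attr pij Ww.
  rewrite (distDl dist_H) -{1}(raddf0 A) (le_trans (A_lip _ _))//.
  by rewrite expr1 ler_wpM2l.
rewrite edensityS => /sum_neq0[k] /econv_support[v [pik]].
rewrite mule_eq0 negb_or => /andP[_ /IH[w Ww wc]].
exists (x - v + A w)%R; first exact: p_attr pik Ww.
rewrite -{1}(subrK v x) (distD2l dist_H) -{1}(AinvK v) (le_trans (A_lip _ _))//.
by rewrite exprS -mulrA ler_wpM2l.
Qed.
End support.

End density_iteration.

(** * From extended-real to real convolutions *)

Section real_densities.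
Context {R : realType} {H : topologicalZmodType}.
Variable theta : {sigma_finite_measure set (borel H) -> \bar R}.
Local Notation X := (borel H).
Hypothesis subr_meas :
  measurable_fun [set: X * X] (fun p : X * X => (p.1 : H) - p.2 : X).
Hypothesis theta_inv : forall (x : H) (B : set X), measurable B ->
  theta [set x + y | y in (B : set H)] = theta B.
Hypothesis theta_neq0 : theta [set: X] != 0%E.
Local Open Scope ereal_scope.
Local Notation conv := (econv theta).

Lemma ge0_integrable (f : H -> \bar R) : ge0_meas f ->
  \int[theta]_(x in [set: X]) f x < +oo -> theta.-integrable [set: X] f.
Proof.
move=> [mf f0] foo; apply/integrableP; split=> //.
by under eq_integral do rewrite gee0_abs//.
Qed.

Lemma ge0_ae_fin_num (f : H -> \bar R) : ge0_meas f ->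
  \int[theta]_(x in [set: X]) f x < +oo -> {ae theta, forall x : X, f x \is a fin_num}.
Proof.
move=> mf foo; have := integrable_ae measurableT (ge0_integrable mf foo).
by apply: filterS => x /(_ I).
Qed.

Lemma measurable_reflectR (f : H -> R) (x : H) : measurable_fun [set: X] (f : X -> R) ->
  measurable_fun [set: X] (fun v : X => f (x - v)%R).
Proof. by move=> mf; exact: (measurableT_comp mf (measurable_reflect subr_meas x)). Qed.

(** The equality holds at every [x]: by [ae_reflect] the two integrands agree for almost every [v],
    and where the integral is infinite both sides are the default value 0. *)
Lemma convol_econv (f g : H -> R) (F G : H -> \bar R) :
  measurable_fun [set: X] (f : X -> R) -> measurable_fun [set: X] (g : X -> R) ->
  ge0_meas F -> ge0_meas G ->
  {ae theta, forall x : X, (f x)%:E = F x} -> {ae theta, forall x : X, (g x)%:E = G x} ->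
  forall x, convol theta f g x = fine (conv F G x).
Proof.
move=> mf mg mF mG fF gG x; congr fine; apply: ae_eq_integral => //.
- apply/measurable_EFinP; apply: measurable_funM => //.
  exact: measurable_reflectR.
- by apply (ge0_measM (ge0_meas_reflect subr_meas x mF) mG).
have := ae_reflect subr_meas theta_inv theta_neq0 x fF.
by apply: filterS2 gG => v /= <- <- _; rewrite EFinM.
Qed.

(** The two integrals can be subtracted where both integrands are integrable in [v]. That is the
    case for almost every [x], since the convolutions of [F] with the absolute values of [u] and [w]
    have finite mass. *)
Lemma abs_convolB_le (f u w : H -> R) (F : H -> \bar R) :
  measurable_fun [set: X] (f : X -> R) -> ge0_meas F ->
  {ae theta, forall x : X, `|f x|%:E = F x} -> \int[theta]_(x in [set: X]) F x < +oo ->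
  theta.-integrable [set: X] (EFin \o u : X -> \bar R) ->
  theta.-integrable [set: X] (EFin \o w : X -> \bar R) ->
  {ae theta, forall x : X, `|convol theta f u x - convol theta f w x|%:E <=
    conv F (fun v => `|u v - w v|%:E) x}.
Proof.
move=> mf mF fF Foo iu iw.
have mabs (u' : H -> R) : measurable_fun [set: X] (u' : X -> R) ->
    ge0_meas (fun v => `|u' v|%:E).
  move=> mu'; split=> [|x]; last by rewrite lee_fin.
  by apply/measurable_EFinP; exact: measurableT_comp.
have convE (u' : H -> R) (x : H) : measurable_fun [set: X] (u' : X -> R) ->
    \int[theta]_(v in [set: X]) `|(f (x - v) * u' v)%:E| =
    conv F (fun v => `|u' v|%:E) x.
  move=> mu'; apply: ae_eq_integral => //.
  - apply: measurableT_comp => //; apply/measurable_EFinP.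
    by apply: measurable_funM => //; exact: measurable_reflectR.
  - by apply (ge0_measM (ge0_meas_reflect subr_meas x mF) (mabs _ mu')).
  have := ae_reflect subr_meas theta_inv theta_neq0 x fF.
  by apply: filterS => v /= <- _; rewrite normrM EFinM.
have fin (u' : H -> R) : theta.-integrable [set: X] (EFin \o u' : X -> \bar R) ->
    {ae theta, forall x : X,
      theta.-integrable [set: X] (EFin \o (fun v => f (x - v) * u' v)%R : X -> \bar R)}.
  move=> /integrableP[/measurable_EFinP mu' u'oo].
  have mc := ge0_meas_econv theta subr_meas mF (mabs _ mu').
  have := ge0_ae_fin_num mc; rewrite (integral_econv subr_meas theta_inv)//; last exact: mabs.
  have -> : \int[theta]_(x in [set: X]) F x *
      \int[theta]_(x in [set: X]) `|u' x|%:E < +oo.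
    apply: lte_mul_pinfty => //; first by apply: integral_ge0 => x _; exact: mF.2.
    by rewrite ge0_fin_numE//; apply: integral_ge0 => x _; exact: mF.2.
  move=> /(_ isT); apply: filterS => x; rewrite fin_numElt => /andP[_ cx].
  apply/integrableP; split.
    by apply/measurable_EFinP; apply: measurable_funM => //; exact: measurable_reflectR.
  by rewrite convE.
have [/measurable_EFinP mu _] := integrableP _ _ _ iu.
have [/measurable_EFinP mw _] := integrableP _ _ _ iw.
apply: filterS2 (fin _ iu) (fin _ iw) => x iux iwx.
rewrite /convol -RintegralB//.
have iB : theta.-integrable [set: X]
    (EFin \o (fun v => f (x - v) * u v - f (x - v) * w v)%R : X -> \bar R).
  have := integrableB measurableT iux iwx; apply: eq_integrable => //.
rewrite -(convE (u \- w)%R); last exact: measurable_funB.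
rewrite (le_trans (y := \int[theta]_(v in [set: X]) `|(f (x - v) * u v - f (x - v) * w v)%:E|))//.
  rewrite EFin_normr_Rintegral//; apply: le_abse_integral => //.
  exact: measurable_int iB.
by under eq_integral do rewrite -mulrBr.
Qed.

(** A null set [N] is the image under [Ainv] of its preimage, whose measure times [alpha] is
    therefore 0; and [alpha] is positive. *)
Lemma ae_comp_Ainv (A : {additive H -> H}) (Ainv : H -> H) (alpha : R) (P : H -> Prop) :
  is_automorphism A Ainv -> is_modulus theta Ainv alpha ->
  {ae theta, forall x : X, P x} -> {ae theta, forall x : X, P (Ainv x)}.
Proof.
move=> [AK AinvK cA cAinv] [a0 Amod] [N [mN N0 PN]].
have mN' : measurable (Ainv @^-1` N : set X).
  by rewrite -[X in measurable X]setTI; exact: continuous_measurable_borel.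
exists (Ainv @^-1` N); split=> //; last by move=> x Px; exact: PN.
apply/eqP; have := Amod _ mN'; rewrite image_preimage => [E|].
  have /eqP : alpha%:E * theta (Ainv @^-1` N : set X) = 0 by rewrite -E; exact: N0.
  by rewrite mule_eq0 eqe gt_eqF.
by apply/seteqP; split=> // x _; exists (A x) => //; rewrite AK.
Qed.

End real_densities.

(** * Real partial densities and the refinement operator *)

Section partial_densities.
Context {R : realType} {H : topologicalZmodType}.
Variable theta : {sigma_finite_measure set (borel H) -> \bar R}.
Local Notation X := (borel H).
Hypothesis subr_meas :
  measurable_fun [set: X * X] (fun p : X * X => (p.1 : H) - p.2 : X).
Hypothesis theta_inv : forall (x : H) (B : set X), measurable B ->
  theta [set x + y | y in (B : set H)] = theta B.
Hypothesis theta_neq0 : theta [set: X] != 0%E.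
Context {A : {additive H -> H}} {Ainv : H -> H} {alpha : R}.
Hypothesis A_aut : is_automorphism A Ainv.
Hypothesis A_mod : is_modulus theta Ainv alpha.
Context {n : nat} {m : 'cV[R]_n} {p : 'I_n -> 'I_n -> H -> \bar R} {h : 'M[H -> R]_n}.
Hypothesis m_gt0 : forall i, 0 < m i 0.
Hypothesis p_meas : forall i j, ge0_meas (p i j).
Local Open Scope ereal_scope.
Hypothesis p_lty : forall i j, \int[theta]_(x in [set: X]) p i j x < +oo.
Hypothesis h_meas : forall i j, measurable_fun [set: X] (h i j : X -> R).
Hypothesis h_p : forall i j, {ae theta, forall x : X, (h i j x)%:E = p i j x}.
Local Notation S := (@escale R H Ainv alpha).
Local Notation conv := (econv theta).
Local Notation sd := (scaled_density alpha Ainv h).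
Local Notation emc := (@emconv_iter R H theta Ainv alpha n p).
Local Notation ed := (@edensity R H theta Ainv alpha n m p).

Lemma scaled_density_escale k i j x :
  (sd k i j x)%:E = iter k S (fun x => (h i j x)%:E) x.
Proof.
rewrite mxE; elim: k x => [|k IH] x; first by rewrite expr0 mul1r.
by rewrite [RHS]/= /escale -IH -EFinM exprS -mulrA iterSr.
Qed.

Lemma measurable_scaled_density k i j : measurable_fun [set: X] (sd k i j : X -> R).
Proof.
rewrite mxE; apply: measurable_funM => //.
have mAinv : measurable_fun [set: X] (Ainv : X -> X).
  by apply: continuous_measurable_borel; have [] := A_aut.
apply: (measurableT_comp (h_meas i j)).
elim: k => [|k IH]; first exact: measurable_id.
exact: (measurableT_comp mAinv IH).
Qed.

Lemma ae_scaled_density k i j :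
  {ae theta, forall x : X, (sd k i j x)%:E = iter k S (p i j) x}.
Proof.
suff : {ae theta, forall x : X, iter k S (fun x => (h i j x)%:E) x = iter k S (p i j) x}.
  by apply: filterS => x <-; exact: scaled_density_escale.
elim: k => [|k IH]; first exact: h_p.
have := ae_comp_Ainv A_aut A_mod IH; apply: filterS => x Ex.
by rewrite !iterS /escale Ex.
Qed.

Lemma ae_sum_fine (f : 'I_n -> H -> \bar R) :
  (forall i, {ae theta, forall x : X, f i x \is a fin_num}) ->
  {ae theta, forall x : X, (\sum_i fine (f i x))%:E = \sum_i f i x}.
Proof.
move=> /filter_forall; apply: filterS => x fx.
by rewrite EFin_sum_fine// => i _; exact: fx.
Qed.

Lemma mconv_iterS l i j : mconv_iter theta sd l.+1 i j =
  fun x => (\sum_k convol theta (mconv_iter theta sd l i k) (sd l.+1 k j) x)%R.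
Proof. by rewrite /= mxE. Qed.

(** By [convol_econv], the summands of the real product are everywhere the [fine] of their
    extended-real counterparts. This gives measurability, and almost everywhere finiteness then
    removes [fine]. *)
Lemma mconv_iter_emconv_iter l i j :
  measurable_fun [set: X] (mconv_iter theta sd l i j : X -> R) /\
  {ae theta, forall x : X, (mconv_iter theta sd l i j x)%:E = emc l i j x}.
Proof.
have mS k i' j' : ge0_meas (iter k S (p i' j')).
  exact: (ge0_meas_iter_escale A_aut A_mod).
elim: l i j => [|l IH] i j.
  split; first exact: measurable_scaled_density.
  exact: ae_scaled_density.
have mE l' i' j' : ge0_meas (emc l' i' j').
  exact: (ge0_meas_emconv_iter subr_meas A_aut A_mod).
have me k : ge0_meas (conv (emc l i k) (iter l.+1 S (p k j))).
  by apply: ge0_meas_econv.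
have E : mconv_iter theta sd l.+1 i j =
    fun x => (\sum_k fine (conv (emc l i k) (iter l.+1 S (p k j)) x))%R.
  rewrite mconv_iterS; apply/funext => x; apply: eq_bigr => k _.
  have [mIH aeIH] := IH i k.
  apply: convol_econv => //; first exact: measurable_scaled_density.
  exact: ae_scaled_density.
rewrite E; split.
  apply: measurable_sum => k.
  by apply: measurableT_comp => //; exact: (me k).1.
apply: ae_sum_fine => k; apply: ge0_ae_fin_num => //.
(* Each summand is dominated by the full nonnegative sum, whose mass is known to be finite. *)
apply: (@le_lt_trans _ _ (\int[theta]_(x in [set: X]) emc l.+1 i j x)); last first.
  exact: (integral_emconv_iter_lty subr_meas theta_inv A_aut A_mod).
apply: ge0_le_integral => //.
- by move=> x _; exact: (me k).2.
- exact: (me k).1.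
- exact: (mE l.+1 i j).1.
- move=> x _ /=; rewrite (bigD1 k)//= leeDl// sume_ge0// => q _.
  exact: (me q).2.
Qed.

Lemma ae_partial_density l i :
  measurable_fun [set: X] (partial_density theta alpha Ainv h m l i 0%R : X -> R) /\
  {ae theta, forall x : X, (partial_density theta alpha Ainv h m l i 0%R x)%:E = ed l i x}.
Proof.
rewrite mxE; split.
  apply: measurable_sum => j; apply: measurable_funM => //.
  by have [] := mconv_iter_emconv_iter l i j.
have : {ae theta, forall x : X, forall j, (mconv_iter theta sd l i j x)%:E = emc l i j x}.
  by apply: filter_forall => j; have [] := mconv_iter_emconv_iter l i j.
apply: filterS => x Ex; rewrite -sumEFin; apply: eq_bigr => j _.
by rewrite EFinM Ex.
Qed.

Definition refine_op (u : 'cV[H -> R]_n) (i : 'I_n) (x : H) : R :=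
  (alpha * \sum_j \int[theta]_(v in [set: X]) (h i j (x - v) * u j 0 (Ainv v)))%R.

Hypothesis p_m : forall i,
  \sum_k \int[theta]_(x in [set: X]) p i k x * (m k 0%R)%:E = (m i 0%R)%:E.

(** For infinite [c] both sides are 0, because [fine] vanishes at both infinities and the product is
    infinite or 0. *)
Lemma fineZ (r : R) (c : \bar R) : fine (r%:E * c) = (r * fine c)%R.
Proof.
case: c => [s||//] /=; rewrite ?mulr0//.
- have [r0|r0|->] := ltgtP r 0%R;
    [by rewrite lt0_muley|by rewrite gt0_muley|by rewrite mul0e].
- have [r0|r0|->] := ltgtP r 0%R;
    [by rewrite lt0_muleNy|by rewrite gt0_muleNy|by rewrite mul0e].
Qed.

Lemma econv_escaler (f g : H -> \bar R) x : ge0_meas f -> ge0_meas g ->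
  conv f (S g) x = alpha%:E * conv f (g \o Ainv) x.
Proof.
move=> mf mg; rewrite muleC -(econvZr theta subr_meas)//.
- by congr (conv _ _ x); apply/funext => y; rewrite /escale muleC.
- by rewrite lee_fin (alpha_ge0 A_mod).
- exact: (ge0_meas_comp_Ainv A_aut).
Qed.

Lemma refine_opE u i x :
  refine_op u i x = (\sum_j alpha * convol theta (h i j) (u j 0%R \o Ainv) x)%R.
Proof. by rewrite /refine_op mulr_sumr. Qed.

Lemma measurable_comp_Ainv (u : H -> R) : measurable_fun [set: X] (u : X -> R) ->
  measurable_fun [set: X] (u \o Ainv : X -> R).
Proof.
move=> mu; apply: (measurableT_comp mu); apply: continuous_measurable_borel.
by have [] := A_aut.
Qed.

(** This is [edensityS] carried over to real functions; each summand has finite mass, so taking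
    [fine] is harmless almost everywhere. *)
Lemma refine_op_partial_density l i :
  {ae theta, forall x : X, refine_op (partial_density theta alpha Ainv h m l) i x =
    partial_density theta alpha Ainv h m l.+1 i 0%R x}.
Proof.
have med j : ge0_meas (ed l j).
  exact: (ge0_meas_edensity subr_meas A_aut A_mod).
have mSed j : ge0_meas (S (ed l j)) by apply: ge0_meas_escale A_aut A_mod _ _.
have mc j : ge0_meas (conv (p i j) (S (ed l j))) by apply: ge0_meas_econv.
have E x : refine_op (partial_density theta alpha Ainv h m l) i x =
    (\sum_j fine (conv (p i j) (S (ed l j)) x))%R.
  rewrite refine_opE; apply: eq_bigr => j _.
  have [mf aef] := ae_partial_density l j.
  rewrite econv_escaler// fineZ; congr (_ * _)%R.
  apply: convol_econv => //; first exact: measurable_comp_Ainv.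
  - exact: (ge0_meas_comp_Ainv A_aut).
  - exact: (ae_comp_Ainv A_aut A_mod aef).
have : {ae theta, forall x : X,
    (\sum_j fine (conv (p i j) (S (ed l j)) x))%:E = ed l.+1 i x}.
  rewrite (edensityS subr_meas theta_inv A_aut A_mod m_gt0 p_meas).
  apply: ae_sum_fine => j; apply: ge0_ae_fin_num => //.
  rewrite (integral_econv subr_meas theta_inv)// (integral_escale A_aut A_mod)//.
  rewrite (integral_edensity subr_meas theta_inv A_aut A_mod m_gt0 p_meas p_m).
  rewrite lte_mul_pinfty ?ltry//; first by apply: integral_ge0 => x _; exact: (p_meas i j).2.
  by rewrite ge0_fin_numE//; apply: integral_ge0 => x _; exact: (p_meas i j).2.
apply: filterS2 (ae_partial_density l.+1 i).2 => x E1 E2.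
by apply: EFin_inj; rewrite E E1 E2.
Qed.

Lemma integrable_comp_Ainv (u : H -> R) :
  theta.-integrable [set: X] (EFin \o u : X -> \bar R) ->
  theta.-integrable [set: X] (EFin \o (u \o Ainv) : X -> \bar R).
Proof.
move=> /integrableP[/measurable_EFinP mu uoo].
have mabs : ge0_meas (fun x => `|u x|%:E).
  split=> [|x]; last by rewrite lee_fin.
  by apply/measurable_EFinP; exact: measurableT_comp.
apply/integrableP; split; first by apply/measurable_EFinP; exact: measurable_comp_Ainv.
move: uoo; rewrite -(integral_escale A_aut A_mod mabs).
rewrite ge0_integralZl//; first last.
- by rewrite lee_fin (alpha_ge0 A_mod).
- exact: (ge0_meas_comp_Ainv A_aut mabs).1.
have := A_mod.1; move: (\int[_]_(x in _) _) => [r||]//= a0; first by move=> _; rewrite ltry.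
by rewrite gt0_muley.
Qed.

(** Integrated, the bound is a Lipschitz estimate for [refine_op] in L1 whose constants are the
    masses of [p]. *)
Lemma refine_op_contract (u w : 'cV[H -> R]_n) i :
  (forall j, theta.-integrable [set: X] (EFin \o u j 0%R : X -> \bar R)) ->
  (forall j, theta.-integrable [set: X] (EFin \o w j 0%R : X -> \bar R)) ->
  {ae theta, forall x : X, `|refine_op u i x - refine_op w i x|%:E <=
    \sum_j conv (p i j) (S (fun v => `|u j 0%R v - w j 0%R v|%:E)) x}.
Proof.
move=> iu iw.
have H1 j : {ae theta, forall x : X,
    `|convol theta (h i j) (u j 0%R \o Ainv) x - convol theta (h i j) (w j 0%R \o Ainv) x|%:E
     <= conv (p i j) (fun v => `|(u j 0%R \o Ainv) v - (w j 0%R \o Ainv) v|%:E) x}.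
  apply: abs_convolB_le => //.
  - apply: filterS (h_p i j) => x E; have := (p_meas i j).2 x.
    by rewrite -E lee_fin => /ger0_norm ->.
  - exact: integrable_comp_Ainv.
  - exact: integrable_comp_Ainv.
move: H1 => /filter_forall; apply: filterS => x Hx.
rewrite !refine_opE -sumrB (le_trans (y := \sum_j (alpha * `|convol theta (h i j) (u j 0%R \o Ainv) x -
  convol theta (h i j) (w j 0%R \o Ainv) x|)%:E))//.
  rewrite sumEFin lee_fin (le_trans (ler_norm_sum _ _ _))//; apply: ler_sum => j _.
  by rewrite -mulrBr normrM ger0_norm ?(alpha_ge0 A_mod).
apply: lee_sum => j _; rewrite econv_escaler//.
  by rewrite EFinM lee_wpmul2l ?lee_fin ?(alpha_ge0 A_mod)//; exact: Hx.
split=> [|y]; last by rewrite lee_fin.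
apply/measurable_EFinP; apply: measurableT_comp => //; apply: measurable_funB.
  by have /integrableP[/measurable_EFinP] := iu j.
by have /integrableP[/measurable_EFinP] := iw j.
Qed.

End partial_densities.

(** * Total variation and L1 limits *)

Lemma le_cvg0_eq0 (R : realType) (x : \bar R) (u : nat -> \bar R) :
  (0 <= x)%E -> (forall l, (x <= u l)%E) -> u l @[l --> \oo] --> 0%E -> x = 0%E.
Proof.
move=> x0 xu u0; apply/eqP; rewrite eq_le x0 andbT -(cvg_lim _ u0)//.
by apply: lime_ge; [exact: cvgP u0|exact: nearW].
Qed.

Lemma cvg0_sume (R : realType) (I : Type) (r : seq I) (u : I -> nat -> \bar R) :
  (forall i, u i l @[l --> \oo] --> 0%E) ->
  (\sum_(i <- r) u i l)%E @[l --> \oo] --> 0%E.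
Proof.
move=> u0; elim: r => [|i r IH].
  rewrite (_ : (fun l => _) = cst 0); first exact: cvg_cst.
  by apply/funext => l; rewrite big_nil.
rewrite (_ : (fun l => _) = (fun l => u i l + \sum_(i <- r) u i l)%E); last first.
  by apply/funext => l; rewrite big_cons.
by have := cvgeD _ (u0 i) IH; rewrite adde0; apply.
Qed.

Section total_variation.
Context {d : measure_display} {T : measurableType d} {R : realType}.
Local Open Scope ereal_scope.

Lemma abs_charge_le_tv_norm (nu : {charge set T -> \bar R}) (B : set T) :
  measurable B -> `|nu B| <= tv_norm nu.
Proof.
move=> mB; rewrite /tv_norm; case: cid => P hP; case: cid => N nuPN.
rewrite (le_trans (abse_charge_variation nuPN mB))//.
by apply: le_measure => //; rewrite inE.
Qed.

(** The hypothesis is used once where [u] is nonnegative and once where it is negative, hence twice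
    [t]. *)
Lemma abs_integral_le2 (mu : {measure set T -> \bar R}) (u : T -> R) (t : \bar R) :
  mu.-integrable [set: T] (EFin \o u) ->
  (forall B, measurable B -> `|\int[mu]_(x in B) (u x)%:E| <= t) ->
  \int[mu]_(x in [set: T]) `|u x|%:E <= t + t.
Proof.
move=> iu ut; have mu_ : measurable_fun [set: T] u.
  by have /integrableP[/measurable_EFinP] := iu.
pose P := [set x | (0 <= u x)%R]; have mP : measurable P.
  rewrite (_ : P = u @^-1` `[0%R, +oo[); last first.
    by apply/seteqP; split=> x; rewrite /P /= in_itv/= andbT.
  by rewrite -[X in measurable X]setTI; exact: mu_.
have mN : measurable (~` P) by exact: measurableC.
rewrite -(setUv P) ge0_integral_setU//; first last.
- exact/disj_setPCl.
- by rewrite setUv; apply/measurable_EFinP; exact: measurableT_comp.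
apply: leeD.
- apply: le_trans (ut P mP); apply: le_trans (lee_abs _).
  by under eq_integral => x /[!inE] Px do rewrite ger0_norm//.
- apply: le_trans (ut (~` P) mN).
  rewrite [X in _ <= `|X|](eq_integral (fun x => - `|u x|%:E)); last first.
    by move=> x /[!inE] /negP; rewrite -ltNge => ux; rewrite ltr0_norm// -EFinN opprK.
  by rewrite integral_ge0N ?abseN ?lee_abs// => x _; rewrite lee_fin.
Qed.

End total_variation.

(** * L1 convergence of the marginal densities *)

Section total_variation_limit.
Context {d' : measure_display} {X : measurableType d'} {R : realType}.
Local Open Scope ereal_scope.

Lemma tv_cvg_density_L1 (mu : {sigma_finite_measure set X -> \bar R}) (n : nat)
    (m : 'I_n -> R) (f : nat -> 'I_n -> X -> R)
    (omega : nat -> {finite_measure set (n.-tuple X) -> \bar R}) :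
  (forall i, (0 < m i)%R) ->
  (forall l i, mu.-integrable [set: X] (EFin \o f l i)) ->
  (forall l i, \int[mu]_(x in [set: X]) (f l i x)%:E = (m i)%:E) ->
  (forall l, is_product_measure (fun i B => \int[mu]_(x in B) (f l i x)%:E) (omega l)) ->
  tv_cvg omega ->
  exists g : 'I_n -> X -> R, forall i, mu.-integrable [set: X] (EFin \o g i) /\
    \int[mu]_(x in [set: X]) `|f l i x - g i x|%:E @[l --> \oo] --> 0.
Proof.
move=> m0 intf intfm omegaE [nu nu_cvg].
set tv := (X in X @ _ --> _) in nu_cvg.
have omega_nu l B : measurable B -> `|omega l B - nu B| <= tv l.
  by move=> mB; exact: (abs_charge_le_tv_norm (cadd (charge_of_finite_measure (omega l)) (copp nu)) mB).
suff H (i : 'I_n) : exists g : X -> R, mu.-integrable [set: X] (EFin \o g) /\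
    \int[mu]_(x in [set: X]) `|f l i x - g x|%:E @[l --> \oo] --> 0.
  by exists (fun i => sval (cid (H i))) => i; exact: svalP (cid (H i)).
(* The factor by which a cylinder over coordinate [i] exceeds its marginal; it is invertible because
   [m] is strictly positive. *)
pose c : R := (\prod_(j < n | j != i) m j)%R.
have c0 : (0 < c)%R by apply: prodr_gt0 => j _; exact: m0.
pose cyl (B : set X) : set (n.-tuple X) := (fun t => tnth t i) @^-1` B.
have mtnth : measurable_fun [set: n.-tuple X] (fun t : n.-tuple X => tnth t i).
  exact: measurable_tnth.
have mcyl B : measurable B -> measurable (cyl B).
  by move=> mB; rewrite -[X in measurable X]setTI; exact: mtnth.
have omega_cyl l B : measurable B ->
    omega l (cyl B) = \int[mu]_(x in B) (f l i x)%:E * c%:E.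
  move=> mB; pose Bs j := if j == i then B else setT.
  have -> : cyl B = [set t | forall j, Bs j (tnth t j)].
    apply/seteqP; split=> [t Bt j|t /(_ i)]; rewrite /Bs ?eqxx//.
    by case: eqVneq => // ->.
  rewrite omegaE; last by move=> j; rewrite /Bs; case: ifP.
  rewrite (bigD1 i)//= {1}/Bs eqxx; congr (_ * _).
  rewrite /c -prodEFin; apply: eq_bigr => j /negbTE ji.
  by rewrite /Bs ji intfm.
have [nui nuiE] : exists nui : {charge set X -> \bar R}, forall B, nui B = nu (cyl B).
  by unshelve eexists (pushforward nu (fun t : n.-tuple X => tnth t i)).
have omega_nui l B : measurable B ->
    `|\int[mu]_(x in B) (f l i x)%:E * c%:E - nui B| <= tv l.
  by move=> mB; rewrite nuiE -omega_cyl//; apply: omega_nu; exact: mcyl.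
(* On a [mu]-null set every [omega l] vanishes on the cylinder, so [nui] is bounded there by [tv l],
   which tends to 0. *)
have nui_mu : nui `<< mu.
  apply/null_content_dominatesP => B mB B0.
  apply/eqP; rewrite -abse_eq0; apply/eqP.
  apply: (le_cvg0_eq0 (abse_ge0 _) _ nu_cvg) => l.
  have := omega_nui l _ mB.
  have -> : \int[mu]_(x in B) (f l i x)%:E = 0.
    by rewrite null_set_integral//; apply: measurable_funTS; exact: measurable_int (intf l i).
  by rewrite mul0e sub0e abseN.
pose G := Radon_Nikodym nui mu.
have iG : mu.-integrable [set: X] G by exact: Radon_Nikodym_integrable.
pose g x := (c^-1 * fine (G x))%R.
have gE x : (c * g x)%:E = G x.
  by rewrite /g mulrA divff ?gt_eqF// mul1r fineK//; exact: Radon_Nikodym_fin_num.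
have ig : mu.-integrable [set: X] (EFin \o g).
  apply: (eq_integrable measurableT (fun x => (c^-1)%:E * G x)).
    by move=> x _; rewrite -gE -EFinM mulrA mulVf ?gt_eqF// mul1r.
  exact: integrableZl.
exists g; split=> //.
(* The charge with density [c * (f l i - g)] is the difference of the marginals, at most [tv l] on
   every set; [abs_integral_le2] turns this into an L1 bound. *)
have bound l : \int[mu]_(x in [set: X]) `|f l i x - g x|%:E <= (c^-1)%:E * (tv l + tv l).
  have iD : mu.-integrable [set: X] (EFin \o (fun x => c * (f l i x - g x))%R).
    apply: (eq_integrable measurableT (fun x => c%:E * ((EFin \o f l i) \- (EFin \o g)) x)) => //.
    by apply: integrableZl => //; exact: integrableB.
  have -> : \int[mu]_(x in [set: X]) `|f l i x - g x|%:E =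
      (c^-1)%:E * \int[mu]_(x in [set: X]) `|(c * (f l i x - g x))|%:E.
    rewrite -ge0_integralZl//; first last.
    - by rewrite lee_fin invr_ge0 ltW.
    - have /integrableP[/measurable_EFinP mD _] := iD.
      by apply/measurable_EFinP; exact: measurableT_comp.
    apply: eq_integral => x _; rewrite -EFinM normrM gtr0_norm// mulrA mulVf ?mul1r//.
    by rewrite gt_eqF.
  apply: lee_wpmul2l; first by rewrite lee_fin invr_ge0 ltW.
  apply: abs_integral_le2 => // B mB.
  apply: le_trans (omega_nui l B mB); rewrite le_eqVlt; apply/orP; left; apply/eqP.
  congr (`|_|).
  have ifB : mu.-integrable B (EFin \o f l i) by exact: integrableS (intf l i).
  have iGB : mu.-integrable B G by exact: integrableS iG.
  transitivity (\int[mu]_(x in B) ((f l i x)%:E * c%:E - G x)).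
    by apply: eq_integral => x _; rewrite -gE -EFinM -EFinB mulrBr mulrC.
  rewrite integralB//; last exact: integrableZr.
  by rewrite integralZr// (Radon_Nikodym_integral nui_mu mB).
have lim0 : (c^-1)%:E * (tv l + tv l) @[l --> \oo] --> 0.
  by rewrite -(mule0 (c^-1)%:E); apply: cvgeZl => //; rewrite -(adde0 0); exact: cvgeD.
apply: squeeze_cvge (cvg_cst 0) lim0; apply: nearW => l.
by rewrite bound andbT integral_ge0// => x _; rewrite lee_fin.
Qed.

End total_variation_limit.

(** * Continuity of translation in L1 *)

Section translation_continuity.
Context {R : realType} {H : topologicalZmodType}.
Variable theta : {sigma_finite_measure set (borel H) -> \bar R}.
Local Notation X := (borel H).
Hypothesis subr_meas :
  measurable_fun [set: X * X] (fun p : X * X => (p.1 : H) - p.2 : X).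
Hypothesis theta_inv : forall (x : H) (B : set X), measurable B ->
  theta [set x + y | y in (B : set H)] = theta B.
Hypothesis theta_outer : forall B : set X, measurable B -> outer_regular_at theta B.
Hypothesis theta_inner : forall U : set H, open U -> inner_regular_at theta U.
Hypothesis compact_meas : forall K : set H, compact K -> measurable (K : set X).
Local Open Scope ereal_scope.

Definition L1_shift (u : H -> R) (t : H) : \bar R :=
  \int[theta]_(x in [set: X]) `|u (x + t)%R - u x|%:E.

Definition L1_shift_cvg0 (u : H -> R) :=
  forall e : R, (0 < e)%R -> \forall t \near (0%R : H), L1_shift u t <= e%:E.

Lemma measurable_shiftR (u : H -> R) (t : H) : measurable_fun [set: X] (u : X -> R) ->
  measurable_fun [set: X] (fun x : X => u (x + t)%R).
Proof. by move=> mu; exact: (measurableT_comp mu (measurable_shift subr_meas t)). Qed.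

Lemma ge0_meas_normB (u w : H -> R) : measurable_fun [set: X] (u : X -> R) ->
  measurable_fun [set: X] (w : X -> R) -> ge0_meas (fun x => `|u x - w x|%:E).
Proof.
move=> mu mw; split=> [|x]; last by rewrite lee_fin.
by apply/measurable_EFinP; apply: measurableT_comp => //; exact: measurable_funB.
Qed.

Lemma ge0_measD (f g : H -> \bar R) : ge0_meas f -> ge0_meas g ->
  ge0_meas (fun x => f x + g x).
Proof.
move=> [mf f0] [mg g0]; split; first exact: emeasurable_funD.
by move=> x; exact: adde_ge0.
Qed.

Lemma integral_ge0_measD (mu : {measure set X -> \bar R}) (f g : H -> \bar R) : ge0_meas f -> ge0_meas g ->
  \int[mu]_(x in [set: X]) (f x + g x) =
  \int[mu]_(x in [set: X]) f x + \int[mu]_(x in [set: X]) g x.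
Proof. by move=> [mf f0] [mg g0]; rewrite ge0_integralD. Qed.

Lemma le_integral_ge0_meas (mu : {measure set X -> \bar R}) (f g : H -> \bar R) : ge0_meas f -> ge0_meas g ->
  (forall x, f x <= g x) ->
  \int[mu]_(x in [set: X]) f x <= \int[mu]_(x in [set: X]) g x.
Proof. by move=> [mf f0] [mg g0] fg; exact: ge0_le_integral. Qed.

(** Translation is an L1 isometry, so the approximation error is paid once for [u] and once for its
    translate. Continuity of translation thereby passes to L1 limits. *)
Lemma L1_shift_triangle (u w : H -> R) (t : H) :
  measurable_fun [set: X] (u : X -> R) -> measurable_fun [set: X] (w : X -> R) ->
  L1_shift u t <= L1_shift w t +
    (\int[theta]_(x in [set: X]) `|u x - w x|%:E + \int[theta]_(x in [set: X]) `|u x - w x|%:E).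
Proof.
move=> mu mw; have muw := ge0_meas_normB mu mw.
have muwt := ge0_meas_shift subr_meas t muw.
have mwt := ge0_meas_normB (measurable_shiftR t mw) mw.
have mut := ge0_meas_normB (measurable_shiftR t mu) mu.
rewrite -{1}(ge0_integral_shift subr_meas theta_inv t muw) /L1_shift.
have mD := ge0_measD muwt muw.
rewrite -integral_ge0_measD// -integral_ge0_measD//.
apply: le_integral_ge0_meas => //; first exact: ge0_measD.
move=> x; rewrite -!EFinD lee_fin.
have -> : (u (x + t) - u x = (w (x + t) - w x) +
    ((u (x + t) - w (x + t)) - (u x - w x)))%R by lra.
by rewrite (le_trans (ler_normD _ _))// lerD2l ler_normB.
Qed.

(** Subtraction is continuous at [(x, 0)] for each [x] in [K]; compactness, in its near-covering
    form, makes the neighbourhood of 0 uniform in [x]. *)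
Lemma compact_shift_sub (K U : set H) : compact K -> open U -> K `<=` U ->
  \forall t \near (0%R : H), forall x, K (x + t)%R -> U x.
Proof.
move=> cK oU KU.
have : \forall t \near (0%R : H), K `<=` (fun x => U (x - t)%R).
  apply: (compact_near_coveringP K).1 cK _ _ (fun t x => U (x - t)%R) _ _ => x Kx.
  have := @sub_continuous H (x, 0%R) U; rewrite /= subr0; apply.
  by apply: open_nbhs_nbhs; split=> //; exact: KU.
by apply: filterS => t KtU x /KtU; rewrite addrK.
Qed.

(** Pointwise, the integrand plus both indicators is twice the indicator of the union. The additive
    form avoids subtracting possibly infinite measures. *)
Lemma integral_indic_symdiff (C D U : set X) : measurable C -> measurable D ->
  measurable U -> C `<=` U -> D `<=` U ->
  \int[theta]_(x in [set: X]) `|\1_C x - \1_D x : R|%:E + (theta C + theta D)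
    <= theta U + theta U.
Proof.
move=> mC mD mU CU DU.
have mi (B : set X) : measurable B -> ge0_meas (fun x => (\1_B x : R)%:E).
  by move=> mB; split=> [|x]; [exact/measurable_EFinP/measurable_indic|rewrite lee_fin].
have iE (B : set X) : measurable B -> theta B = \int[theta]_(x in [set: X]) (\1_B x)%:E.
  by move=> mB; rewrite integral_indic// setIT.
have mCD : ge0_meas (fun x => `|\1_C x - \1_D x : R|%:E).
  by apply: ge0_meas_normB; exact: measurable_indic.
have mC' := mi _ mC; have mD' := mi _ mD; have mU' := mi _ mU.
rewrite !iE// -!integral_ge0_measD//; last exact: ge0_measD.
apply: le_integral_ge0_meas; [|exact: ge0_measD|].
  by apply: ge0_measD => //; exact: ge0_measD.
move=> x; rewrite -!EFinD lee_fin !indicE.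
have [xC|xC] := boolP (x \in C); have [xD|xD] := boolP (x \in D).
- by rewrite (mem_set (CU x (set_mem xC))) subrr normr0 add0r.
- by rewrite (mem_set (CU x (set_mem xC))) subr0 normr1 addr0.
- by rewrite (mem_set (DU x (set_mem xD))) sub0r normrN normr1 add0r.
- by rewrite subrr normr0 !addr0.
Qed.

Lemma L1_shift_cvg0_indic (B : set X) : measurable B -> theta B < +oo ->
  L1_shift_cvg0 (\1_B).
Proof.
(* An open [U] around [B] and a compact [K] inside [U] each lose at most [r]. Exchanging [B] for [K]
   costs [2r] twice and shifting [K] costs another [2r]. *)
move=> mB Boo e e0; pose r := (e / 6)%R.
have r0 : (0 < r)%R by rewrite divr_gt0.
have fB : theta B \is a fin_num by rewrite ge0_fin_numE.
have finB : ereal_inf [set theta U | U in [set U : set H | open U /\ B `<=` U]]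
    \is a fin_num by rewrite -(theta_outer mB).
have [_ [U [oU BU] <-]] := lb_ereal_inf_adherent r0 finB.
rewrite -(theta_outer mB) => Ur.
have fU : theta (U : set X) \is a fin_num.
  rewrite ge0_fin_numE// (lt_trans Ur)//.
  by rewrite lte_add_pinfty ?ltry.
have finU : ereal_sup [set theta K | K in [set K : set H | compact K /\ K `<=` U]]
    \is a fin_num by rewrite -(theta_inner oU).
have [_ [K [cK KU] <-]] := ub_ereal_sup_adherent r0 finU.
rewrite -(theta_inner oU) => Kr.
have mK := compact_meas cK; have mU := open_measurable_borel oU.
have lefin (E : set X) : measurable E -> E `<=` U -> theta E \is a fin_num.
  move=> mE EU; move: fU; rewrite !ge0_fin_numE//; apply: le_lt_trans.
  by apply: le_measure; rewrite ?inE.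
(* Two subsets of [U] that each miss at most [r] of its measure differ by at most [2r]. This serves
   for the pair [B], [K] and for [K] with its translate. *)
have small (C D : set X) : measurable C -> measurable D -> C `<=` U -> D `<=` U ->
    theta U - r%:E <= theta C -> theta U - r%:E <= theta D ->
    \int[theta]_(x in [set: X]) `|\1_C x - \1_D x : R|%:E <= (r + r)%:E.
  move=> mC mD CU DU Cr Dr.
  have := integral_indic_symdiff mC mD mU CU DU.
  move: (\int[_]_(x in _) _) Cr Dr => I.
  rewrite -(fineK (lefin C mC CU)) -(fineK (lefin D mD DU)) -(fineK fU).
  rewrite -EFinB -!EFinD !lee_fin; case: I => [s||]//=; last by move=> *; rewrite leNye.
  rewrite -?EFinD ?lee_fin//.
  by move=> *; lra.
have cB : \int[theta]_(x in [set: X]) `|\1_B x - \1_K x : R|%:E <= (r + r)%:E.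
  by apply: small => //; [rewrite leeBlDr//; exact: ltW|exact: ltW].
apply: filterS (compact_shift_sub cK oU KU) => t Kt.
have Kshift : L1_shift (\1_K) t <= (r + r)%:E.
  have mKt : measurable ((fun x : X => (x + t)%R : X) @^-1` K).
    by rewrite -[X in measurable X]setTI; exact: measurable_shift.
  apply: small => //; last exact: ltW.
  have Et : theta ((fun x : X => (x + t)%R : X) @^-1` K) = theta (K : set X).
    by rewrite (preimage_shift t K); exact: theta_inv.
  by rewrite [leRHS]Et; exact: ltW.
apply: le_trans (@L1_shift_triangle (\1_B : H -> R) (\1_K : H -> R) t _ _) _.
- exact: measurable_indic.
- exact: measurable_indic.
apply: le_trans (leeD Kshift (leeD cB cB)) _.
by rewrite -!EFinD lee_fin /r; lra.
Qed.

Lemma L1_shift_cvg0D (u w : H -> R) : measurable_fun [set: X] (u : X -> R) ->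
  measurable_fun [set: X] (w : X -> R) -> L1_shift_cvg0 u -> L1_shift_cvg0 w ->
  L1_shift_cvg0 (fun x => u x + w x)%R.
Proof.
move=> mu mw cu cw e e0; have e2 : (0 < e / 2)%R by rewrite divr_gt0.
apply: filterS2 (cu _ e2) (cw _ e2) => t ut wt.
have mut := ge0_meas_normB (measurable_shiftR t mu) mu.
have mwt := ge0_meas_normB (measurable_shiftR t mw) mw.
rewrite (splitr e) EFinD; apply: le_trans (leeD ut wt).
rewrite /L1_shift -integral_ge0_measD//.
have muw := measurable_funD mu mw.
apply: le_integral_ge0_meas => //; [|exact: ge0_measD|].
  exact: (ge0_meas_normB (measurable_shiftR t muw) muw).
move=> x; rewrite -EFinD lee_fin (_ : (u (x + t) + w (x + t) - (u x + w x) =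
  (u (x + t) - u x) + (w (x + t) - w x))%R); first exact: ler_normD.
lra.
Qed.

Lemma L1_shift_cvg0Z (c : R) (u : H -> R) : measurable_fun [set: X] (u : X -> R) ->
  L1_shift_cvg0 u -> L1_shift_cvg0 (fun x => c * u x)%R.
Proof.
move=> mu cu e e0; have c1 : (0 < `|c| + 1)%R by rewrite ltr_wpDl.
have := cu (e / (`|c| + 1))%R (divr_gt0 e0 c1); apply: filterS => t ut.
have mut := ge0_meas_normB (measurable_shiftR t mu) mu.
rewrite /L1_shift; under eq_integral do rewrite -mulrBr normrM EFinM.
rewrite ge0_integralZl//; [|exact: mut.1].
apply: (@le_trans _ _ (`|c|%:E * (e / (`|c| + 1))%:E)); first exact: lee_wpmul2l.
by rewrite -EFinM lee_fin mulrCA ler_piMr ?(ltW e0)// ler_pdivrMr// mul1r lerDl.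
Qed.

Lemma L1_shift_cvg0_sum (I : Type) (r : seq I) (u : I -> H -> R) :
  (forall i, measurable_fun [set: X] (u i : X -> R)) ->
  (forall i, L1_shift_cvg0 (u i)) -> L1_shift_cvg0 (fun x => \sum_(i <- r) u i x)%R.
Proof.
move=> mu cu; elim: r => [|i r IH].
  move=> e e0; apply: nearW => t; rewrite /L1_shift.
  under eq_integral do rewrite !big_nil subrr normr0.
  by rewrite integral0 lee_fin ltW.
have -> : (fun x => \sum_(i <- i :: r) u i x)%R = (fun x => u i x + \sum_(i <- r) u i x)%R.
  by apply/funext => x; rewrite big_cons.
apply: L1_shift_cvg0D => //; exact: measurable_sum.
Qed.

Import HBSimple.

Lemma L1_shift_cvg0_sfun (u : {sfun X >-> R}) :
  theta.-integrable [set: X] (EFin \o u) -> L1_shift_cvg0 u.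
Proof.
move=> iu; have mu y : measurable (u @^-1` [set y]) by exact: measurable_sfunP.
have -> : (u : X -> R) = (fun x => \sum_(y <- fset_set (range u)) y * \1_(u @^-1` [set y]) x)%R.
  by apply/funext => x; rewrite fimfunE fsbig_finite.
have mi y : measurable_fun [set: X] (\1_(u @^-1` [set y]) : X -> R).
  exact: measurable_indic.
apply: L1_shift_cvg0_sum => y; first exact: measurable_funM.
(* The level set of 0 may have infinite measure, but its term vanishes; the other level sets have
   finite measure by integrability. *)
have [->|y0] := eqVneq y 0%R.
  move=> e e0; apply: nearW => t; rewrite /L1_shift.
  under eq_integral do rewrite !mul0r subrr normr0.
  by rewrite integral0 lee_fin ltW.
apply: L1_shift_cvg0Z => //; apply: L1_shift_cvg0_indic => //.
have /integrableP[_ uoo] := iu.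
have : `|y|%:E * theta (u @^-1` [set y]) < +oo.
  apply: le_lt_trans uoo.
  have -> : theta (u @^-1` [set y]) = \int[theta]_(x in [set: X]) (\1_(u @^-1` [set y]) x)%:E.
    by rewrite integral_indic// setIT.
  rewrite -ge0_integralZl//; last exact/measurable_EFinP.
  apply: ge0_le_integral => //.
  - by apply/measurable_EFinP; exact: measurable_funM.
  - by apply: measurableT_comp => //; apply/measurable_EFinP; exact: measurable_funP.
  move=> x _; rewrite -EFinM lee_fin indicE; have [/set_mem /= ->|_] := boolP (x \in _).
    by rewrite mulr1.
  by rewrite mulr0.
rewrite lt_neqAle => /andP[H1 _]; rewrite ltey; apply: contra_neq H1 => ->.
by rewrite gt0_muley// lte_fin normr_gt0.
Qed.

Lemma L1_shift_cvg0_integrable (u : H -> R) :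
  theta.-integrable [set: X] (EFin \o u : X -> \bar R) -> L1_shift_cvg0 u.
Proof.
move=> iu e e0; have e3 : (0 < e / 3)%R by rewrite divr_gt0.
have [g [ig _ ug]] := approximation_sfun_integrable measurableT iu.
have [k gk] : exists k, \int[theta]_(x in [set: X]) `|u x - g k x|%:E < (e / 3)%:E.
  move: ug => /fine_cvgP[[N _ fN] /cvgr_lt/(_ _ e3)[M _ gM]].
  exists (maxn N M).
  have := fN (maxn N M) (leq_maxl _ _); have := gM (maxn N M) (leq_maxr _ _).
  by rewrite /= => /[swap] /fineK <-; rewrite lte_fin.
apply: filterS (L1_shift_cvg0_sfun (ig k) e3) => t gt.
apply: le_trans (@L1_shift_triangle u (g k) t _ _) _ => //.
  by have /integrableP[/measurable_EFinP] := iu.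
apply: le_trans (leeD gt (leeD (ltW gk) (ltW gk))) _.
by rewrite -!EFinD lee_fin; lra.
Qed.

Lemma integral_shift_integrable (u : H -> R) (t : H) :
  theta.-integrable [set: X] (EFin \o u : X -> \bar R) ->
  theta.-integrable [set: X] (fun x : X => (u (x + t)%R)%:E) /\
  \int[theta]_(x in [set: X]) (u (x + t)%R)%:E = \int[theta]_(x in [set: X]) (u x)%:E.
Proof.
move=> /integrableP[/measurable_EFinP mu uoo].
have mut := measurable_shiftR t mu.
have mpos (w : H -> \bar R) : measurable_fun [set: X] (w : X -> \bar R) ->
   ge0_meas (fun x => w^\+ x) /\ ge0_meas (fun x => w^\- x).
  move=> mw; split; split=> // ; [exact: measurable_funepos|exact: measurable_funeneg].
split.
  apply/integrableP; split; first exact/measurable_EFinP.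
  have mabs : ge0_meas (fun x => `|u x|%:E).
    split=> [|x]; last by rewrite lee_fin.
    by apply/measurable_EFinP; exact: measurableT_comp.
  by rewrite -(ge0_integral_shift subr_meas theta_inv t mabs) in uoo.
have [mp mn] := mpos (EFin \o u) ((measurable_EFinP _ _).2 mu).
rewrite integralE [RHS]integralE.
have Ep := ge0_integral_shift subr_meas theta_inv t mp.
have En := ge0_integral_shift subr_meas theta_inv t mn.
rewrite (funepos_comp (EFin \o u) (fun x : X => (x + t)%R : X)).
rewrite (funeneg_comp (EFin \o u) (fun x : X => (x + t)%R : X)).
exact: (congr2 (fun a b => a - b) Ep En).
Qed.

Lemma continuous_convol (M : R) (h u : H -> R) :
  measurable_fun [set: X] (h : X -> R) -> (forall x, (`|h x| <= M)%R) ->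
  theta.-integrable [set: X] (EFin \o u : X -> \bar R) ->
  continuous (convol theta h u).
Proof.
move=> mh hM iu x0.
have mu : measurable_fun [set: X] (u : X -> R).
  by have /integrableP[/measurable_EFinP] := iu.
have M0 : (0 <= M)%R by exact: le_trans (hM 0%R).
have ihu (w : H -> R) x : theta.-integrable [set: X] (EFin \o w : X -> \bar R) ->
    theta.-integrable [set: X] (EFin \o (fun v => h (x - v) * w v)%R : X -> \bar R).
  move=> iw; apply: (le_integrable measurableT _ _ (integrableZl measurableT M iw)).
  - apply/measurable_EFinP; apply: measurable_funM; first exact: measurable_reflectR.
    by have /integrableP[/measurable_EFinP] := iw.
  - move=> v _ /=; rewrite lee_fin !normrM (ger0_norm M0) ler_wpM2r ?hM//.
have iut t := integral_shift_integrable t iu.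
have diff t x : `|convol theta h u (x + t)%R - convol theta h u x|%:E <=
    M%:E * L1_shift u t.
  (* The shift is moved from [h] to [u] by substituting [v + t] for [v], so the increment is
     governed by translation of the integrable factor and the bound on the other. *)
  have -> : convol theta h u (x + t)%R =
      (\int[theta]_(v in [set: X]) (h (x - v) * u (v + t)))%R.
    rewrite /convol /Rintegral; congr fine.
    rewrite -((integral_shift_integrable t (ihu u (x + t)%R iu)).2).
    apply: eq_integral => v _; congr ((h _ * _)%:E).
    by rewrite (addrC v) addrKA.
  rewrite /convol -RintegralB//; [|exact: (ihu _ x (iut t).1)|exact: ihu].
  have iB : theta.-integrable [set: X]
      (EFin \o (fun v => h (x - v) * u (v + t) - h (x - v) * u v)%R : X -> \bar R).
    have := integrableB measurableT (ihu _ x (iut t).1) (ihu _ x iu).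
    by apply: eq_integrable.
  rewrite EFin_normr_Rintegral//.
  apply: le_trans (le_abse_integral theta measurableT (measurable_int _ iB)) _.
  have mut := ge0_meas_normB (measurable_shiftR t mu) mu.
  rewrite /L1_shift -ge0_integralZl//; [|exact: mut.1].
  have mhu : ge0_meas (fun v => `|h (x - v) * u (v + t) - h (x - v) * u v|%:E).
    split=> [|v]; last by rewrite lee_fin.
    by have /integrableP[/measurable_EFinP mB _] := iB;
      apply/measurable_EFinP; exact: measurableT_comp.
  apply: le_integral_ge0_meas => //; first exact: ge0_measZ.
  by move=> v; rewrite -EFinM lee_fin -mulrBr normrM ler_wpM2r.
apply/cvgrPdist_le => e e0.
(* The bound [M] may be 0, hence the division by [M + 1]. *)
have M1 : (0 < M + 1)%R by rewrite ltr_wpDl.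
have near0 := L1_shift_cvg0_integrable iu (divr_gt0 e0 M1).
have sub0 : {for x0, continuous (fun x : H => (x - x0)%R)}.
  apply: (@continuous_comp H (H * H)%type H (fun x => (x, x0)) (fun p => (p.1 - p.2)%R)).
    by apply: cvg_pair; [exact: cvg_id|exact: cvg_cst].
  exact: sub_continuous.
rewrite /prop_for /continuous_at subrr in sub0.
apply: (@filterS H (nbhs x0) (nbhs_filter x0) _ _ _ (sub0 _ near0)) => x /= xe.
rewrite distrC -lee_fin.
have := diff (x - x0)%R x0; rewrite addrCA subrr addr0 => /le_trans; apply.
apply: (@le_trans _ _ (M%:E * (e / (M + 1))%:E)); first exact: lee_wpmul2l.
by rewrite -EFinM lee_fin mulrCA ler_piMr ?(ltW e0)// ler_pdivrMr// mul1r lerDl.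
Qed.

End translation_continuity.

(** Tonelli and Radon-Nikodym take a bundled sigma-finite measure; the equality lets the final proof
    substitute one for [theta]. *)
Lemma sigma_finite_measure_pack d (T : measurableType d) (R : realType)
    (mu : {measure set T -> \bar R}) : sigma_finite [set: T] mu ->
  exists mu' : {sigma_finite_measure set T -> \bar R}, mu' = mu :> {measure set T -> \bar R}.
Proof.
move=> sf.
pose sfmix := isSFinite.Build _ _ _ _ (sfinite_measure_sigma_finite sf).
pose sgmix := isSigmaFinite.Build _ _ _ _ sf.
pose mu' := HB.pack_for (SigmaFiniteMeasure.type T R) (Measure.sort mu) sfmix sgmix.
by exists mu'; exact: eq_measure.
Qed.

(** * Almost everywhere properties of L1 limits *)

Section L1_limits.
Context {R : realType} {H : topologicalZmodType}.
Variable theta : {measure set (borel H) -> \bar R}.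
Local Notation X := (borel H).
Local Open Scope ereal_scope.

(** As [Z] may fail to be measurable, the integral is taken of the pointwise infimum [C] of the
    bounds instead. It is at most every integral of [B l], so [C], and with it [Z], vanishes almost
    everywhere. *)
Lemma ae0_of_L1_bounds (Z : H -> R) (B : nat -> H -> \bar R) :
  (forall l, ge0_meas (B l)) ->
  (forall l, {ae theta, forall x : X, `|Z x|%:E <= B l x}) ->
  \int[theta]_(x in [set: X]) B l x @[l --> \oo] --> 0 ->
  {ae theta, forall x : X, Z x = 0%R}.
Proof.
move=> mB ZB B0; pose C (x : H) := einfs (B ^~ x) 0%N.
have CB l x : C x <= B l x by apply: ereal_inf_lbound; exists l.
have C0 x : 0 <= C x by apply: le_ereal_inf_tmp => _ [l _ <-]; exact: (mB l).2.
have mC : measurable_fun [set: X] (C : X -> \bar R).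
  by apply: measurable_fun_einfs => l; exact: (mB l).1.
have : \int[theta]_(x in [set: X]) `|C x| = 0.
  apply: (le_cvg0_eq0 _ _ B0) => [|l]; first by apply: integral_ge0.
  apply: ge0_le_integral => //; first exact: measurableT_comp.
  - exact: (mB l).1.
  - by move=> x _; rewrite gee0_abs.
move=> /ae_eq_integral_abs => /(_ measurableT mC).
have ZBl : {ae theta, forall x : X, forall l, `|Z x|%:E <= B l x} by exact: ae_foralln.
apply: filterS2 ZBl => x Zx /(_ I) Cx.
apply/eqP; rewrite -normr_eq0 eq_le normr_ge0 andbT -lee_fin.
by rewrite -[leRHS]Cx; apply: le_ereal_inf_tmp => _ [l _ <-]; exact: Zx.
Qed.

Section limit.
Context {f : nat -> H -> R} {g : H -> R}.
Hypothesis f_int : forall l, theta.-integrable [set: X] (EFin \o f l : X -> \bar R).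
Hypothesis g_int : theta.-integrable [set: X] (EFin \o g : X -> \bar R).
Hypothesis fg : \int[theta]_(x in [set: X]) `|f l x - g x|%:E @[l --> \oo] --> 0.

Lemma integrable_ge0_measB (u w : H -> R) :
  theta.-integrable [set: X] (EFin \o u : X -> \bar R) ->
  theta.-integrable [set: X] (EFin \o w : X -> \bar R) ->
  ge0_meas (fun x => `|u x - w x|%:E).
Proof.
by move=> /integrableP[/measurable_EFinP mu _] /integrableP[/measurable_EFinP mw _];
  exact: ge0_meas_normB.
Qed.

(** Where [f l] is nonnegative, the negative part of [g] is at most the distance from [g] to
    [f l]. *)
Lemma L1_limit_ge0 : (forall l, {ae theta, forall x : X, (0 <= f l x)%R}) ->
  {ae theta, forall x : X, (0 <= g x)%R}.
Proof.
move=> f0; have : {ae theta, forall x : X, Num.min (g x) 0%R = 0%R}.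
  apply: (ae0_of_L1_bounds (fun l => integrable_ge0_measB (f_int l) g_int) _ fg) => l.
  apply: filterS (f0 l) => x fx; rewrite lee_fin; have [gx|gx] := leP (g x) 0%R.
    by rewrite (ler0_norm gx) ger0_norm; lra.
  by rewrite normr0.
by apply: filterS => x; have [gx gx0|gx _] := leP (g x) 0%R; [rewrite gx0|exact: ltW].
Qed.

Lemma L1_limit_integral (c : R) :
  (forall l, \int[theta]_(x in [set: X]) (f l x)%:E = c%:E) ->
  \int[theta]_(x in [set: X]) (g x)%:E = c%:E.
Proof.
move=> fc; have gfin : \int[theta]_(x in [set: X]) (g x)%:E \is a fin_num.
  exact: integrable_fin_num.
have : `|\int[theta]_(x in [set: X]) (g x)%:E - c%:E| = 0.
  apply: (le_cvg0_eq0 (abse_ge0 _) _ fg) => l.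
  rewrite -(fc l) -integralB//; last exact: f_int.
  have mB := integrable_ge0_measB (f_int l) g_int.
  have iB := integrableB measurableT g_int (f_int l).
  apply: le_trans (le_abse_integral theta measurableT (measurable_int _ iB)) _.
  by under eq_integral => x _ do rewrite /= distrC.
by move/eqP; rewrite abse_eq0 sube_eq// add0e => /eqP.
Qed.

Lemma L1_limit_eq0 (U : set H) (N : nat) :
  (forall l, (N <= l)%N -> {ae theta, forall x : X, U x -> f l x = 0%R}) ->
  {ae theta, forall x : X, U x -> g x = 0%R}.
Proof.
move=> fU; pose Z x := if x \in U then g x else 0%R.
have : {ae theta, forall x : X, Z x = 0%R}.
  apply: (@ae0_of_L1_bounds Z (fun l x => `|f (l + N)%N x - g x|%:E)).
  - by move=> l; exact: integrable_ge0_measB.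
  - move=> l; apply: filterS (fU (l + N)%N (leq_addl _ _)) => x fx.
    rewrite lee_fin /Z; case: ifPn => [/set_mem /fx ->|_]; last by rewrite normr0.
    by rewrite sub0r normrN.
  - by rewrite (cvg_shiftn N (fun l => \int[theta]_(x in [set: X]) `|f l x - g x|%:E) _).
by apply: filterS => x + Ux; rewrite /Z mem_set.
Qed.

Lemma L1_limit_unique (g' : H -> R) :
  theta.-integrable [set: X] (EFin \o g' : X -> \bar R) ->
  \int[theta]_(x in [set: X]) `|f l x - g' x|%:E @[l --> \oo] --> 0 ->
  {ae theta, forall x : X, g' x = g x}.
Proof.
move=> g'_int fg'.
have mB l := integrable_ge0_measB (f_int l) g_int.
have mB' l := integrable_ge0_measB (f_int l) g'_int.
have : {ae theta, forall x : X, (g' x - g x)%R = 0%R}.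
  apply: (@ae0_of_L1_bounds _ (fun l x => `|f l x - g x|%:E + `|f l x - g' x|%:E)).
  - by move=> l; exact: ge0_measD.
  - move=> l; apply: nearW => x; rewrite -EFinD lee_fin.
    rewrite (_ : g' x - g x = (f l x - g x) - (f l x - g' x))%R; last lra.
    exact: ler_normB.
  - rewrite (_ : (fun l => _) = (fun l => \int[theta]_(x in [set: X]) `|f l x - g x|%:E +
        \int[theta]_(x in [set: X]) `|f l x - g' x|%:E)); last first.
      by apply/funext => l; rewrite integral_ge0_measD.
    by rewrite -(adde0 0); exact: cvgeD.
by apply: filterS => x /subr0_eq.
Qed.

End limit.
End L1_limits.

(** Evaluation at 0 is continuous for the compact-open topology, because the singleton of 0 is
    compact. *)
Lemma compact_translation_parts (H : topologicalZmodType)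
    (F : set {compact-open, H -> H}) : compact F -> compact (translation_parts F).
Proof.
move=> cF; apply: (@continuous_compact {compact-open, H -> H} H (fun f => f 0)) => //.
apply: continuous_subspaceT => f U; rewrite nbhsE; case=> O [oO Of] OU.
have o0 := @compact_open_open H H _ _ (@compact_set1 H 0) oO.
apply: (@filterS _ _ _ ([set g | g @` [set 0] `<=` O] : set {compact-open, H -> H})).
  by move=> g gO; apply: OU; apply: gO; exists 0.
by apply: open_nbhs_nbhs; split=> // _ [_ -> <-].
Qed.

Section real_functions.
Context {R : realType} {H : topologicalZmodType}.
Local Notation X := (borel H).
Local Open Scope ereal_scope.

Lemma ae_eq0_of_null_integral (theta : {measure set X -> \bar R}) (h : H -> R) (D : set H) :
  measurable_fun [set: X] (h : X -> R) -> {ae theta, forall x : X, (0 <= h x)%R} ->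
  measurable (D : set X) -> density theta h D = 0 ->
  {ae theta, forall x : X, D x -> h x = 0%R}.
Proof.
move=> mh h0 mD hD.
have mhD : measurable_fun (D : set X) (EFin \o h : X -> \bar R).
  by apply/measurable_EFinP; exact: measurable_funTS.
have : \int[theta]_(x in (D : set X)) `|(EFin \o h) x| = 0.
  rewrite -hD; apply: ae_eq_integral => //; first exact: measurableT_comp.
  by apply: filterS h0 => x hx _ /=; rewrite ger0_norm.
move=> /ae_eq_integral_abs => /(_ mD mhD); apply: filterS => x hx Dx.
by apply: EFin_inj; exact: hx.
Qed.

(** Truncation at the essential bound gives a representative bounded at every point, as
    [continuous_convol] requires. *)
Lemma Lfun_infty_bounded (theta : {measure set X -> \bar R}) (h : H -> R) :
  theta [set: X] != 0 -> h \in Lfun theta +oo ->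
  exists M (h' : H -> R), [/\ measurable_fun [set: X] (h' : X -> R),
    forall x, (`|h' x| <= M)%R & {ae theta, forall x : X, h x = h' x}].
Proof.
move=> theta0; rewrite inE => /andP[/[!inE]/= mh].
(* The norm at exponent [+oo] is defined by cases on the total mass; [theta0] selects the essential
   supremum. *)
rewrite /finite_norm unlock /Lnorm ifT; last by rewrite lt0e theta0/=.
move=> /(@ess_supr_bounded _ X _ theta (fun x : X => `|h x|%R))[M hM].
exists `|M|%R, (fun x => Num.min (Num.max (h x) (- `|M|)) `|M|)%R; split.
- apply: measurable_minr; last exact: measurable_cst.
  by apply: measurable_maxr => //; exact: measurable_cst.
- move=> x; rewrite ler_norml; apply/andP; split.
    by rewrite le_min le_max lexx orbT/= ge0_cp.
  by rewrite ge_min lexx orbT.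
- apply: filterS hM => x hx; have {}hx : (`|h x| <= `|M|)%R.
    by rewrite (le_trans hx)// ler_norm.
  move: hx; rewrite ler_norml => /andP[h1 h2].
  by rewrite (max_idPl h1) (min_idPl h2).
Qed.

End real_functions.

(** * The limit density *)

Section refinement_operator.
Context {R : realType} {H : topologicalZmodType}.
Variable theta : {sigma_finite_measure set (borel H) -> \bar R}.
Local Notation X := (borel H).
Hypothesis subr_meas :
  measurable_fun [set: X * X] (fun p : X * X => (p.1 : H) - p.2 : X).
Hypothesis theta_inv : forall (x : H) (B : set X), measurable B ->
  theta [set x + y | y in (B : set H)] = theta B.
Hypothesis theta_neq0 : theta [set: X] != 0%E.
Hypothesis theta_outer : forall B : set X, measurable B -> outer_regular_at theta B.
Hypothesis theta_inner : forall U : set H, open U -> inner_regular_at theta U.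
Hypothesis compact_meas : forall K : set H, compact K -> measurable (K : set X).
Context {A : {additive H -> H}} {Ainv : H -> H} {alpha : R}.
Hypothesis A_aut : is_automorphism A Ainv.
Hypothesis A_mod : is_modulus theta Ainv alpha.
Context {n : nat} {m : 'cV[R]_n} {p : 'I_n -> 'I_n -> H -> \bar R} {h : 'M[H -> R]_n}.
Hypothesis m_gt0 : forall i, 0 < m i 0.
Hypothesis p_meas : forall i j, ge0_meas (p i j).
Local Open Scope ereal_scope.
Hypothesis p_lty : forall i j, \int[theta]_(x in [set: X]) p i j x < +oo.
Hypothesis h_meas : forall i j, measurable_fun [set: X] (h i j : X -> R).
Hypothesis h_p : forall i j, {ae theta, forall x : X, (h i j x)%:E = p i j x}.
Hypothesis p_m : forall i,
  \sum_k \int[theta]_(x in [set: X]) p i k x * (m k 0%R)%:E = (m i 0%R)%:E.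
Local Notation f l i := (partial_density theta alpha Ainv h m l i 0%R : H -> R).
Local Notation S := (@escale R H Ainv alpha).
Local Notation conv := (econv theta).
Local Notation T := (@refine_op R H theta Ainv alpha n h).

Lemma refine_op_fixpoint (g : 'cV[H -> R]_n) :
  (forall l i, theta.-integrable [set: X] (EFin \o f l i : X -> \bar R)) ->
  (forall i, theta.-integrable [set: X] (EFin \o g i 0%R : X -> \bar R)) ->
  (forall i, \int[theta]_(x in [set: X]) `|f l i x - g i 0%R x|%:E @[l --> \oo] --> 0) ->
  forall i, {ae theta, forall x : X, g i 0%R x = T g i x}.
Proof.
move=> f_int g_int fg i.
have md l j := integrable_ge0_measB (f_int l j) (g_int j).
have mS l j : ge0_meas (S (fun v => `|f l j v - g j 0%R v|%:E)).
  exact: (ge0_meas_escale A_aut A_mod).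
have mc l j : ge0_meas (conv (p i j) (S (fun v => `|f l j v - g j 0%R v|%:E))).
  exact: ge0_meas_econv.
have msum l := ge0_meas_sum (mc l).
have : {ae theta, forall x : X, (g i 0%R x - T g i x)%R = 0%R}.
  (* Insert [f l.+1], which is [T (f l)] almost everywhere: the first term measures its distance to
     [g], the second bounds its distance to [T g]. *)
  apply: (@ae0_of_L1_bounds _ _ _ _ (fun l x => `|f l.+1 i x - g i 0%R x|%:E +
      \sum_j conv (p i j) (S (fun v => `|f l j v - g j 0%R v|%:E)) x)).
  - by move=> l; exact: ge0_measD.
  - move=> l.
    have Hc := refine_op_contract subr_meas theta_inv theta_neq0 A_aut A_mod p_meas p_lty
      h_meas h_p i (f_int l) g_int.
    have Hf := refine_op_partial_density subr_meas theta_inv theta_neq0 A_aut A_mod m_gt0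
      p_meas p_lty h_meas h_p p_m l i.
    apply: filterS2 Hc Hf => x Hc Hf.
    apply: le_trans (leeD (lexx _) Hc); rewrite -EFinD lee_fin Hf.
    rewrite (_ : g i 0 x - T g i x =
      (f l.+1 i x - T g i x) - (f l.+1 i x - g i 0 x))%R; last lra.
    by rewrite [leRHS]addrC; exact: ler_normB.
  - rewrite (_ : (fun l => _) = (fun l =>
        \int[theta]_(x in [set: X]) `|f l.+1 i x - g i 0%R x|%:E +
        \sum_j \int[theta]_(x in [set: X]) p i j x *
          \int[theta]_(x in [set: X]) `|f l j x - g j 0%R x|%:E)); last first.
      apply/funext => l; rewrite integral_ge0_measD//; congr (_ + _).
      rewrite integral_sum_measurable//; apply: eq_bigr => j _.
      by rewrite (integral_econv subr_meas theta_inv)// (integral_escale A_aut A_mod).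
    have fgS : \int[theta]_(x in [set: X]) `|f l.+1 i x - g i 0%R x|%:E @[l --> \oo] --> 0.
      by rewrite (cvg_shiftS (fun l => \int[theta]_(x in [set: X]) `|f l i x - g i 0%R x|%:E)).
    have sum0 : \sum_j \int[theta]_(x in [set: X]) p i j x *
        \int[theta]_(x in [set: X]) `|f l j x - g j 0%R x|%:E @[l --> \oo] --> 0.
      apply: cvg0_sume => j; rewrite -(mule0 (\int[theta]_(x in [set: X]) p i j x)).
      apply: cvgeZl => //; rewrite ge0_fin_numE//.
      by apply: integral_ge0 => x _; exact: (p_meas i j).2.
    by have := cvgeD _ fgS sum0; rewrite adde0; apply.
by apply: filterS => x /subr0_eq.
Qed.

Lemma ae_eq_convol (k k' u : H -> R) :
  measurable_fun [set: X] (k : X -> R) -> measurable_fun [set: X] (k' : X -> R) ->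
  measurable_fun [set: X] (u : X -> R) ->
  {ae theta, forall x : X, k x = k' x} -> convol theta k u = convol theta k' u.
Proof.
move=> mk mk' mu kk'; apply/funext => x; congr fine; apply: ae_eq_integral => //.
- by apply/measurable_EFinP; apply: measurable_funM => //; exact: measurable_reflectR.
- by apply/measurable_EFinP; apply: measurable_funM => //; exact: measurable_reflectR.
have := ae_reflect subr_meas theta_inv theta_neq0 x kk'.
by apply: filterS => v -> _.
Qed.

(** Replacing [h i j] by a bounded representative leaves the convolution unchanged at every point,
    so the operator's own values are continuous. *)
Lemma continuous_refine_op (u : 'cV[H -> R]_n) (i : 'I_n) :
  (forall j, h i j \in Lfun theta +oo) ->
  (forall j, theta.-integrable [set: X] (EFin \o u j 0%R : X -> \bar R)) ->
  continuous (T u i : H -> R).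
Proof.
move=> h_oo u_int.
have cc j : continuous (convol theta (h i j) (u j 0%R \o Ainv)).
  have [M [h' [mh' h'M hh']]] := Lfun_infty_bounded theta_neq0 (h_oo j).
  have iu := integrable_comp_Ainv A_aut A_mod (u_int j).
  rewrite (@ae_eq_convol _ h')//; last by have /integrableP[/measurable_EFinP] := iu.
  exact: continuous_convol.
rewrite (_ : T u i = fun x => \sum_j alpha * convol theta (h i j) (u j 0%R \o Ainv) x)%R; last first.
  by apply/funext => x; rewrite refine_opE.
move=> x; apply: (@cvg_big R _ +%R 0%R) => [|j _].
  exact: add_continuous.
by apply: cvgM; [exact: cvg_cst|exact: cc].
Qed.

End refinement_operator.

Theorem proposition5p2 (R : realType) (H : topologicalZmodType)
  (Hlc : locally_compact [set: H])
  (dist : H -> H -> R) (dist_H : invariant_complete_metric dist)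
  (theta : {measure set (borel H) -> \bar R})
  (theta_haar : is_haar_measure theta)
  (A : {additive H -> H}) (Ainv : H -> H)
  (A_aut : is_automorphism A Ainv) (A_contr : contractive dist A)
  (alpha : R) (A_mod : is_modulus theta Ainv alpha)
  (n : nat) (F : 'I_n -> 'I_n -> set {compact-open, H -> H})
  (F_aff : forall i j, compact_affine_family A (F i j))
  (W : 'I_n -> set H) (W_attr : is_attractor F W)
  (sigma : 'I_n -> 'I_n -> {finite_measure set (borel H) -> \bar R})
  (sigma_F : forall i j, is_regular_measure_on_family (F i j) (sigma i j))
  (m : 'cV[R]_n) (m_gt0 : forall i, 0 < m i 0)
  (sm : (\matrix_(i, j) fine (sigma i j [set: H])) *m m = m)
  (h : 'M[H -> R]_n) (h_L1 : forall i j, nonneg_L1 theta (h i j))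
  (sigma_h : forall i j (B : set (borel H)), measurable B ->
     sigma i j B = density theta (h i j) B)
  (omega : nat -> {finite_measure set (n.-tuple (borel H)) -> \bar R})
  (omegaE : forall l, is_product_measure
     (fun i => density theta (partial_density theta alpha Ainv h m l i 0))
     (omega l))
  (omega_cvg : tv_cvg omega) :
  let solution (g : 'cV[H -> R]_n) :=
    (forall i, nonneg_L1 theta (g i 0)) /\
    cvg_L1 theta (partial_density theta alpha Ainv h m) g /\
    (forall i,
      [/\ {ae theta, forall x : H, g i 0 x =
             alpha * \sum_j \int[theta]_v (h i j (x - v) * g j 0 (Ainv v))},
          \int[theta]_x g i 0 x = m i 0 &
          ess_supp theta (g i 0) `<=` W i]) in
  exists g : 'cV[H -> R]_n,
    [/\ solution g,
        forall g' : 'cV[H -> R]_n, solution g' ->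
          forall i, {ae theta, forall x : H, g' i 0 x = g i 0 x} &
        (forall i j, h i j \in Lfun theta 1 /\ h i j \in Lfun theta +oo) ->
          forall i, exists2 f : H -> R, continuous f &
            {ae theta, forall x : H, g i 0 x = f x}].
Proof.
have [AK AinvK cA cAinv] := A_aut.
have [q /andP[q0 q1] Aq] := contractiveW dist_H A_contr.
have [thS thSE] := sigma_finite_measure_pack
  (haar_sigma_finite dist_H Hlc A_aut A_contr theta_haar).
subst theta.
have subr_meas := measurable_subr dist_H Hlc A_aut A_contr.
have [theta_neq0 _ theta_outer theta_inner theta_inv] := theta_haar.
have h_meas i j : measurable_fun [set: borel H] (h i j : borel H -> R).
  by have [/Lfun1_integrable/integrableP[/measurable_EFinP]] := h_L1 i j.
have h_ge0 i j : {ae thS, forall x : borel H, 0 <= h i j x} by have [] := h_L1 i j.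
have F_meas i j : measurable (translation_parts (F i j) : set (borel H)).
  apply: (compact_measurable_borel dist_H); apply: compact_translation_parts.
  by have [] := F_aff i j.
(* Representatives of [h] vanishing everywhere off [F_ij(0)], so that supports
   can be followed pointwise. *)
pose p (i j : 'I_n) (x : H) : \bar R :=
  (\1_(translation_parts (F i j)) x * Num.max (h i j x) 0)%:E.
have p_meas i j : ge0_meas (p i j).
  split=> [|x]; last by rewrite /p lee_fin mulr_ge0// le_max lexx orbT.
  apply/measurable_EFinP; apply: measurable_funM; first exact: measurable_indic.
  by apply: measurable_maxr => //; exact: measurable_cst.
have h_p i j : {ae thS, forall x : borel H, (h i j x)%:E = p i j x}.
  have h_F : {ae thS, forall x : borel H, (~` translation_parts (F i j)) x -> h i j x = 0}.
    apply: ae_eq0_of_null_integral => //; first exact: measurableC.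
    by rewrite -sigma_h; [have [_ ->] := sigma_F i j|exact: measurableC].
  apply: filterS2 (h_ge0 i j) h_F => x hx hF; rewrite /p.
  rewrite indicE (max_idPl hx); have [_|/negP xF] := boolP (x \in _).
    by rewrite mul1r.
  by rewrite mul0r hF// => xF'; apply: xF; exact: mem_set.
have p_int i j : (\int[thS]_(x in [set: borel H]) p i j x = sigma i j [set: H])%E.
  rewrite [RHS]sigma_h//; apply: ae_eq_integral => //.
  - exact: (p_meas i j).1.
  - exact/measurable_EFinP.
  - by apply: filterS (h_p i j) => x ->.
have p_lty i j : (\int[thS]_(x in [set: borel H]) p i j x < +oo)%E.
  by rewrite p_int ltey_eq fin_num_measure.
have p_m i : (\sum_k \int[thS]_(x in [set: borel H]) p i k x * (m k 0)%:E = (m i 0)%:E)%E.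
  have /matrixP/(_ i 0) := sm; rewrite mxE => <-.
  rewrite -sumEFin; apply: eq_bigr => k _.
  by rewrite mxE EFinM fineK ?p_int// fin_num_measure.
pose f l i : H -> R := partial_density thS alpha Ainv h m l i 0.
pose ed := @edensity R H thS Ainv alpha n m p.
have f_meas l i : measurable_fun [set: borel H] (f l i : borel H -> R).
  by have [] := ae_partial_density (m := m) subr_meas theta_inv theta_neq0 A_aut A_mod p_meas p_lty h_meas h_p l i.
have f_ed l i : {ae thS, forall x : borel H, (f l i x)%:E = ed l i x}.
  by have [] := ae_partial_density (m := m) subr_meas theta_inv theta_neq0 A_aut A_mod p_meas p_lty h_meas h_p l i.
have med l i : ge0_meas (ed l i) by exact: (ge0_meas_edensity subr_meas A_aut A_mod).
have int_ed l i : (\int[thS]_(x in [set: borel H]) ed l i x = (m i 0)%:E)%E.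
  exact: (integral_edensity subr_meas theta_inv A_aut A_mod m_gt0 p_meas p_m).
have int_f l i : (\int[thS]_(x in [set: borel H]) (f l i x)%:E = (m i 0)%:E)%E.
  rewrite -(int_ed l i); apply: ae_eq_integral => //.
  - exact/measurable_EFinP.
  - exact: (med l i).1.
  - by apply: filterS (f_ed l i) => x ->.
have f_ge0 l i : {ae thS, forall x : borel H, 0 <= f l i x}.
  by apply: filterS (f_ed l i) => x E; rewrite -lee_fin E; exact: (med l i).2.
have f_int l i : thS.-integrable [set: borel H] (EFin \o f l i : borel H -> \bar R).
  apply/integrableP; split; first exact/measurable_EFinP.
  rewrite (ae_eq_integral (ed l i : borel H -> \bar R))//.
  - by rewrite int_ed ltry.
  - by apply: measurableT_comp => //; exact/measurable_EFinP.
  - exact: (med l i).1.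
  - by apply: filterS2 (f_ed l i) (f_ge0 l i) => x <- fx _ /=; rewrite ger0_norm.
have [g0 g0P] := tv_cvg_density_L1 (m := fun i => m i 0) m_gt0 f_int int_f omegaE omega_cvg.
pose g : 'cV[H -> R]_n := \col_i g0 i.
have g_int i : thS.-integrable [set: borel H] (EFin \o g i 0 : borel H -> \bar R).
  by rewrite mxE; have [] := g0P i.
have g_cvg i : (\int[thS]_(x in [set: borel H]) `|f l i x - g i 0 x|%:E @[l --> \oo] --> 0)%E.
  by under eq_cvg do under eq_integral do rewrite mxE; have [] := g0P i.
have solE (u : 'cV[H -> R]_n) : cvg_L1 thS (partial_density thS alpha Ainv h m) u ->
    forall i, (\int[thS]_(x in [set: borel H]) `|f l i x - u i 0 x|%:E @[l --> \oo] --> 0)%E.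
  move=> uP i; have := uP i; under eq_cvg do rewrite Lnorm1.
  by [].
have fixed i : {ae thS, forall x : H, g i 0 x =
    alpha * \sum_j \int[thS]_v (h i j (x - v) * g j 0 (Ainv v))}.
  exact: (refine_op_fixpoint (m := m) subr_meas theta_inv theta_neq0 A_aut A_mod m_gt0
    p_meas p_lty h_meas h_p p_m f_int g_int g_cvg).
(* Such a [v] is [k 0] for some [k] in [F i j], hence [v + A w = k w], which lies in [W i] by the
   attractor equation. *)
have p_attr i j v w : p i j v != 0%E -> W j w -> W i (v + A w).
  rewrite eqe mulf_eq0 negb_or => /andP[+ _] Ww; rewrite indicE pnatr_eq0 eqb0 negbK.
  move=> /set_mem[k Fk <-]; have [_ /(_ k Fk)[t kE]] := F_aff i j.
  rewrite (W_attr.2 i); exists j => //; exists k => //; exists w => //.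
  by rewrite kE raddf0 add0r addrC.
have supp i : ess_supp thS (g i 0) `<=` W i.
  move=> x xg; apply: contrapT => Wx.
  have W_closed : closed (W i).
    by apply: compact_closed; [exact: dist_hausdorff dist_H|exact: (W_attr.1 i).2].
  have [e e0 eW] : exists2 e : R, 0 < e & [set y | dist x y < e] `<=` ~` W i.
    by apply/(nbhs_distP dist_H)/open_nbhs_nbhs; split=> //; exact: closed_openC.
  pose w j := sval (cid (W_attr.1 j).1).
  have wW j : W j (w j) by exact: svalP (cid (W_attr.1 j).1).
  (* The sum bounds all the distances [dist 0 (w j)] at once. *)
  pose c := \sum_j dist 0 (w j).
  have wc j : exists2 w, W j w & dist 0 w <= c.
    exists (w j) => //; rewrite /c (bigD1 j)//= lerDl sumr_ge0// => k _.
    exact: dist_ge0 dist_H _ _.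
  (* Half of [e] is for the ball [U] around [x], half for the distance from the support of [f l] to
     [W i]; together they would put a point of [W i] in the ball of radius [e]. *)
  have e2 : 0 < e / 2 by rewrite divr_gt0.
  have : (q ^+ l * c) @[l --> \oo] --> 0.
    rewrite -(mul0r c); apply: cvgM; last exact: cvg_cst.
    by apply: cvg_expr; rewrite ger0_norm.
  move=> /cvgr_lt /(_ _ e2) [N _ Ne].
  pose U := [set y | dist x y < e / 2].
  have oU : open U by exact: open_dball dist_H _ _.
  have gU : {ae thS, forall y : borel H, U y -> g i 0 y = 0}.
    apply: (L1_limit_eq0 (N := N) (fun l => f_int l i) (g_int i) (g_cvg i)) => l Nl.
    apply: filterS (f_ed l i) => y fy Uy; apply: EFin_inj; rewrite fy.
    apply/eqP/negPn/negP => edy.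
    have [v Wv yv] := edensity_support subr_meas theta_inv A_aut A_mod m_gt0 p_meas dist_H q0 Aq p_attr wc edy.
    apply: (eW v) => //=; rewrite (le_lt_trans (dist_triangle dist_H y _ _))//.
    rewrite (splitr e) ltrD// (le_lt_trans yv)//.
    by apply: Ne => /=; rewrite (leq_trans Nl).
  have mgi : measurable_fun [set: borel H] (g i 0 : borel H -> R).
    by have /integrableP[/measurable_EFinP] := g_int i.
  have mU0 : measurable (U `&` [set y | g i 0 y != 0] : set (borel H)).
    apply: measurableI; first exact: open_measurable_borel.
    rewrite (_ : [set y | _] = g i 0 @^-1` (~` [set 0])); last first.
      by apply/seteqP; split=> y /= /eqP.
    by rewrite -[X in measurable X]setTI; apply: mgi => //; exact: measurableC.
  have Ux : U x by rewrite /U /= (distxx dist_H).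
  have /negP := xg U oU Ux; apply.
  have [N0 [mN0 N00 gN0]] := gU.
  rewrite -measure_le0 -[leRHS]N00; apply: le_measure; rewrite ?inE//.
  by move=> y [Uy /= gy]; apply: gN0 => /= /(_ Uy)/eqP; exact/negP.
exists g; split.
- split.
    move=> i; split; first exact/Lfun1_integrable.
    exact: (L1_limit_ge0 (fun l => f_int l i) (g_int i) (g_cvg i) (fun l => f_ge0 l i)).
  split.
    by move=> i; under eq_cvg do rewrite Lnorm1; exact: g_cvg.
  move=> i; split; first exact: fixed.
    have := L1_limit_integral (fun l => f_int l i) (g_int i) (g_cvg i) (fun l => int_f l i).
    by rewrite /Rintegral => ->.
  exact: supp.
- move=> g' [g'_L1 [/solE g'_cvg _]] i.
  apply: (L1_limit_unique (fun l => f_int l i) (g_int i) (g_cvg i)) => //.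
  by have [/Lfun1_integrable] := g'_L1 i.
(* The continuous representative is the right-hand side of the fixed-point equation itself. *)
- move=> h_bdd i; exists (@refine_op R H thS Ainv alpha n h g i); last exact: fixed.
  apply: (continuous_refine_op subr_meas theta_inv theta_neq0 theta_outer theta_inner _
    A_aut A_mod) => //; first exact: compact_measurable_borel dist_H.
  by move=> j; have [] := h_bdd i j.
Qed.
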